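(* There exists a group $AMp(V)$ which is a central extension of $ASp(V)$ by the group $\mu_4\subset\mathbb{C}^\times$ of fourth roots of unity, and a linear representation $\rho: AMp(V)\to GL(\mathcal{H})$ lying over the projective representation $\widetilde{\rho}:ASp(V)\to PGL(\mathcal{H})$; that is, for every $x\in AMp(V)$ with image $g\in ASp(V)$, the class of $\rho(x)$ in $PGL(\mathcal{H})$ is $\widetilde{\rho}(g)$.
   Context: Let $K$ be an unramified extension of $\mathbb{Q}_2$ of degree $d$, $\mathcal{O}_K$ its ring of integers, $\mathfrak{m}_K=2\mathcal{O}_K$ the maximal ideal, $k=\mathcal{O}_K/\mathfrak{m}_K=\mathbb{F}_{2^d}$, $R=\mathcal{O}_K/\mathfrak{m}_K^2$, and $tr:R\to\mathbb{Z}/4$ the trace map. Let $\psi:R\to\mathbb{C}^\times$, $\psi(z)=e^{\frac{2\pi i}{4}tr(z)}$. Let $(\widetilde{V},\widetilde{\omega})$ be a free symplectic $R$-module of rank $2n$, and $V=\widetilde{V}/2\widetilde{V}$, a $k$-vector space. The form $2\widetilde{\omega}$ factors to a non-degenerate skew-symmetric form $\omega$ on $V$ with values in $R$; $Sp(V)$ is the group of $k$-linear automorphisms of $V$ preserving $\omega$. Fix a splitting $\widetilde{V}=\widetilde{L}_0\times\widetilde{M}_0$ into free Lagrangian submodules, and put $\widetilde{\beta}((l_1,m_1),(l_2,m_2))=\widetilde{\omega}(l_1,m_2)$. Then $2\widetilde{\beta}$ factors to $\beta:V\times V\to R$, a cocycle with $\beta(u,v)-\beta(v,u)=\omega(u,v)$.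 The Heisenberg group is $H(V)=V\times R$ with $(v_1,z_1)\cdot(v_2,z_2)=(v_1+v_2,z_1+z_2+\beta(v_1,v_2))$; its center is $Z=\{(0,z):z\in R\}\cong R$. For $g\in Sp(V)$ let $\Sigma_g$ be the set of functions $\alpha:V\to R$ with $\alpha(v_1+v_2)-\alpha(v_1)-\alpha(v_2)=\beta(gv_1,gv_2)-\beta(v_1,v_2)$ for all $v_1,v_2\in V$. The affine symplectic group is $ASp(V)=\{(g,\alpha):g\in Sp(V),\alpha\in\Sigma_g\}$ with $(g,\alpha_g)\cdot(h,\alpha_h)=(gh,\alpha_g\circ h+\alpha_h)$. It acts on $H(V)$ by automorphisms trivial on the center: $(g,\alpha)$ sends $(v,z)$ to $(gv,z+\alpha(v))$. Let $(\pi,H(V),\mathcal{H})$ be the Heisenberg representation: the irreducible complex representation of $H(V)$, unique up to isomorphism, with $\pi|_Z=\psi\cdot Id_{\mathcal{H}}$. The projective representation $\widetilde{\rho}:ASp(V)\to PGL(\mathcal{H})$ is characterized by $\widetilde{\rho}(g)\pi(h)\widetilde{\rho}(g)^{-1}=\pi(g(h))$ for all $g\in ASp(V)$, $h\in H(V)$. *)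

(* Defs.v *)
From HB Require Import structures.
From mathcomp Require Import all_boot all_order all_algebra all_fingroup all_field.
From mathcomp Require Import generic_quotient ring_quotient complex.
From mathcomp Require Import boolp classical_sets reals trigo.

Set Implicit Arguments.
Unset Strict Implicit.
Unset Printing Implicit Defensive.

Import GRing.Theory.
Local Open Scope ring_scope.

(* An element of Z_2 = lim Z/2^n is the sequence of its residues; [dyadicP]
   forces dyadic_res n < 2 ^ n, so residues are canonical representatives. *)
Record Z2 := Dyadic {
  dyadic_res :> nat -> nat;
  dyadicP : forall n, dyadic_res n = (dyadic_res n.+1 %% 2 ^ n)%N }.

HB.instance Definition _ := gen_eqMixin Z2.
HB.instance Definition _ := gen_choiceMixin Z2.

Section DyadicRing.
Implicit Types x y z : Z2.

Lemma dyadic_eq x y : (forall n, x n = y n %[mod 2 ^ n]) -> x = y.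
Proof.
case: x y => [x Px] [y Py] /= xy.
have {xy} xy : x = y.
  apply: functional_extensionality_dep => n.
  by rewrite Px Py -(modn_dvdm (x n.+1) (dvdn_exp2l 2 (leqnSn n))) xy modn_dvdm ?dvdn_exp2l.
by subst y; congr Dyadic; apply: Prop_irrelevance.
Qed.

Lemma dyadic_small x n : (x n %% 2 ^ n)%N = x n.
Proof. by rewrite [RHS]dyadicP dyadicP modn_mod. Qed.

Lemma dyadic_le x m n : (m <= n)%N -> (x n %% 2 ^ m)%N = x m.
Proof.
move=> /subnK <-; elim: (n - m)%N => [|k IH]; first by rewrite dyadic_small.
by rewrite addSn -IH (dyadicP x (k + m)) modn_dvdm // dvdn_exp2l // leq_addl.
Qed.

Lemma dyadic_of_subproof (f : nat -> nat) :
  (forall n, f n = f n.+1 %[mod 2 ^ n]) ->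
  forall n, (f n %% 2 ^ n = (f n.+1 %% 2 ^ n.+1) %% 2 ^ n)%N.
Proof. by move=> H n; rewrite H modn_dvdm // dvdn_exp2l. Qed.

Definition dyadic_of f H := Dyadic (@dyadic_of_subproof f H).

Lemma dyadic_ofE f H n : @dyadic_of f H n = f n %[mod 2 ^ n].
Proof. by rewrite /= modn_mod. Qed.

Lemma dyadicS x n : x n = x n.+1 %[mod 2 ^ n].
Proof. by rewrite {1}dyadicP modn_mod. Qed.

Lemma dyadic_nat_subproof (k n : nat) : k = k %[mod 2 ^ n]. Proof. by []. Qed.
Lemma dyadic_add_subproof x y n :
  (x n + y n = x n.+1 + y n.+1 %[mod 2 ^ n])%N.
Proof. by rewrite -modnDm dyadicS (dyadicS y) modnDm. Qed.
Lemma dyadic_mul_subproof x y n :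
  (x n * y n = x n.+1 * y n.+1 %[mod 2 ^ n])%N.
Proof. by rewrite -modnMm dyadicS (dyadicS y) modnMm. Qed.
Lemma dyadic_opp_subproof x n :
  (2 ^ n - x n = 2 ^ n.+1 - x n.+1 %[mod 2 ^ n])%N.
Proof.
have xlt m : (x m <= 2 ^ m)%N.
  by rewrite -dyadic_small ltnW // ltn_mod expn_gt0.
apply/eqP; rewrite -(eqn_modDr (x n.+1)) subnK // -modnDmr -dyadicS modnDmr.
by rewrite subnK // expnS mulnC modnMr modnn.
Qed.

Definition dyadic_nat k := dyadic_of (dyadic_nat_subproof k).
Definition dyadic_add x y := dyadic_of (dyadic_add_subproof x y).
Definition dyadic_mul x y := dyadic_of (dyadic_mul_subproof x y).
Definition dyadic_opp x := dyadic_of (dyadic_opp_subproof x).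

Lemma dyadic_addA : associative dyadic_add.
Proof.
by move=> x y z; apply: dyadic_eq => n; rewrite !dyadic_ofE modnDml modnDmr addnA.
Qed.
Lemma dyadic_addC : commutative dyadic_add.
Proof. by move=> x y; apply: dyadic_eq => n; rewrite !dyadic_ofE addnC. Qed.
Lemma dyadic_add0 : left_id (dyadic_nat 0) dyadic_add.
Proof. by move=> x; apply: dyadic_eq => n; rewrite !dyadic_ofE modnDml. Qed.
Lemma dyadic_addN : left_inverse (dyadic_nat 0) dyadic_opp dyadic_add.
Proof.
move=> x; apply: dyadic_eq => n; rewrite !dyadic_ofE modnDml subnK ?modnn ?mod0n//.
by rewrite -dyadic_small ltnW // ltn_mod expn_gt0.
Qed.
HB.instance Definition _ := GRing.isZmodule.Build Z2
  dyadic_addA dyadic_addC dyadic_add0 dyadic_addN.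

Lemma dyadic_mulA : associative dyadic_mul.
Proof.
by move=> x y z; apply: dyadic_eq => n; rewrite !dyadic_ofE modnMml modnMmr mulnA.
Qed.
Lemma dyadic_mulC : commutative dyadic_mul.
Proof. by move=> x y; apply: dyadic_eq => n; rewrite !dyadic_ofE mulnC. Qed.
Lemma dyadic_mul1 : left_id (dyadic_nat 1) dyadic_mul.
Proof. by move=> x; apply: dyadic_eq => n; rewrite !dyadic_ofE modnMml mul1n. Qed.
Lemma dyadic_mulD : left_distributive dyadic_mul dyadic_add.
Proof.
by move=> x y z; apply: dyadic_eq => n; rewrite !dyadic_ofE modnMml modnDm mulnDl.
Qed.
Lemma dyadic_1neq0 : dyadic_nat 1 != 0.
Proof. by apply/eqP => /(congr1 (fun x : Z2 => x 1%N)). Qed.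
HB.instance Definition _ := GRing.Zmodule_isComNzRing.Build Z2
  dyadic_mulA dyadic_mulC dyadic_mul1 dyadic_mulD dyadic_1neq0.

Definition dyadic_unit : {pred Z2} := fun x => `[< exists y, y * x = 1 >].
Definition dyadic_inv x :=
  if pselect (exists y, y * x = 1) is left h then projT1 (cid h) else x.
Lemma dyadic_mulV : {in dyadic_unit, left_inverse 1 dyadic_inv *%R}.
Proof.
move=> x /asboolP h; rewrite /dyadic_inv; case: pselect => // h'.
exact: (projT2 (cid h')).
Qed.
Lemma dyadic_unitPl x y : y * x = 1 -> dyadic_unit x.
Proof. by move=> h; apply/asboolP; exists y. Qed.
Lemma dyadic_inv_out : {in [predC dyadic_unit], dyadic_inv =1 id}.
Proof. by move=> x /asboolP h; rewrite /dyadic_inv; case: pselect. Qed.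
HB.instance Definition _ := GRing.ComNzRing_hasMulInverse.Build Z2
  dyadic_mulV dyadic_unitPl dyadic_inv_out.

Lemma dyadic_idomain : GRing.integral_domain_axiom Z2.
Proof.
move=> x y xy0; apply/contraT; rewrite negb_or => /andP[xN0 yN0]; exfalso.
have ex z : z != 0 -> exists n, (z n %% 2 ^ n != 0)%N.
  move=> zN0; apply/not_existsP => h; move/eqP: zN0; apply; apply: dyadic_eq => n.
  by rewrite dyadic_ofE mod0n; apply/eqP; move: (h n) => /negP; rewrite negbK.
have [n xn] := ex x xN0; have [m ym] := ex y yN0.
have xN : (x (n + m)%N %% 2 ^ n != 0)%N.
  by rewrite dyadic_le ?leq_addr // -dyadic_small.
have yN : (y (n + m)%N %% 2 ^ m != 0)%N.
  by rewrite dyadic_le ?leq_addl // -dyadic_small.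
have : (2 ^ (n + m) %| x (n + m) * y (n + m))%N.
  have := congr1 (fun z : Z2 => z (n + m)%N) xy0.
  by rewrite /= mod0n => /eqP.
have gt0 k (z : nat) : (z %% 2 ^ k != 0)%N -> (0 < z)%N by case: z => //; rewrite mod0n.
rewrite pfactor_dvdn // ?muln_gt0 ?(gt0 _ _ xN) ?(gt0 _ _ yN) // lognM ?(gt0 _ _ xN) ?(gt0 _ _ yN) //.
apply/negP; rewrite -ltnNge.
have lt k (z : nat) : (z %% 2 ^ k != 0)%N -> (logn 2 z < k)%N.
  by move=> h; move: (h); rewrite ltnNge -pfactor_dvdn ?(gt0 _ _ h).
by rewrite -addSn leq_add ?lt // ltnW // lt.
Qed.
HB.instance Definition _ :=
  GRing.ComUnitRing_isIntegral.Build Z2 dyadic_idomain.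

End DyadicRing.

Notation Q2 := {fraction Z2}.

Section IntegerRing.
Variable K : fieldExtType Q2.

Definition Z2_to_K : Z2 -> K := in_alg K \o @tofrac Z2.
HB.instance Definition _ := GRing.RMorphism.on Z2_to_K.

Definition integral_mem : {pred K} := fun x => `[< integralOver Z2_to_K x >].

Lemma integral_mem_subring : subring_closed integral_mem.
Proof.
split=> [|x y /asboolP hx /asboolP hy|x y /asboolP hx /asboolP hy]; apply/asboolP.
- exact: integral1.
- exact: integral_sub.
- exact: integral_mul.
Qed.
HB.instance Definition _ := GRing.isSubringClosed.Build K integral_mem
  integral_mem_subring.

Definition OK := {x : K | x \in integral_mem}.
HB.instance Definition _ := SubChoice.on OK.
HB.instance Definition _ := [SubChoice_isSubComNzRing of OK by <:].

(* With m_K = 2 O_K, this is ramification index 1; the residue field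
   extension is automatically separable, F_2 being perfect. *)
Definition unramified : Prop :=
  forall x : OK, ~ (exists y : OK, y * x = 1) <-> exists y : OK, x = 2%:R * y.

Lemma integral_2nunit (y : K) : integralOver Z2_to_K y -> 2%:R * y <> 1.
Proof.
move=> [p pmon /rootP py] y2.
pose n := (size p).-1.
have sp : size p = n.+1 by rewrite /n prednK // lt0n size_poly_eq0 monic_neq0.
have lc : p`_n = 1 by move/monicP: pmon; rewrite lead_coefE.
pose t : Z2 := \sum_(i < n) p`_i * 2%:R ^+ (n - i.+1).
have inj : injective Z2_to_K.
  by move=> a b /fmorph_inj /eqP; rewrite tofrac_eq => /eqP.
have /inj t0 : Z2_to_K (1 + 2%:R * t) = Z2_to_K 0.
  have spf : size (map_poly Z2_to_K p) = n.+1.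
    by rewrite size_map_poly_id0 ?sp // (monicP pmon) rmorph1 oner_neq0.
  have coefE i : (map_poly Z2_to_K p)`_i = Z2_to_K p`_i by rewrite coef_map.
  rewrite [RHS]rmorph0 -[RHS](mulr0 (2%:R ^+ n)) -py horner_coef spf.
  rewrite big_ord_recr /= coefE lc rmorph1 mul1r mulrDr -exprMn y2 expr1n.
  rewrite rmorphD rmorph1 rmorphM rmorph_nat /t rmorph_sum /= addrC.
  congr (_ + _); rewrite !mulr_sumr; apply: eq_bigr => i _.
  rewrite coefE rmorphM rmorphXn rmorph_nat /=.
  rewrite mulrCA -exprS subnSK ?ltn_ord // mulrCA; congr (_ * _).
  have -> : 2%:R ^+ n = 2%:R ^+ (n - i) * 2%:R ^+ i :> K.
    by rewrite -exprD subnK // ltnW.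
  by rewrite -mulrA -exprMn y2 expr1n mulr1.
have := congr1 (fun z : Z2 => z 1%N) t0.
by rewrite /= !expn1 modnDmr.
Qed.

Lemma OK_2nunit (y : OK) : 2%:R * y != 1.
Proof.
apply/eqP => /(congr1 (val : OK -> K)).
by rewrite rmorphM rmorph_nat rmorph1; apply/integral_2nunit/asboolP/(valP y).
Qed.

Definition max_ideal : {pred OK} := fun x => `[< exists y : OK, x = 2%:R * y >].
(* m_K ^ 2 = 4 O_K, as m_K = 2 O_K is principal *)
Definition max_ideal_sq : {pred OK} :=
  fun x => `[< exists y : OK, x = 2%:R ^+ 2 * y >].

Lemma principal_idealr_closed (c : OK) : (forall y, c * y != 1) ->
  idealr_closed (fun x => `[< exists y : OK, x = c * y >]).
Proof.
move=> cN1; split.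
- by apply/asboolP; exists 0; rewrite mulr0.
- by apply/asboolP => -[y y1]; move: (cN1 y); rewrite -y1 eqxx.
- move=> a _ _ /asboolP[x ->] /asboolP[y ->]; apply/asboolP.
  by exists (a * x + y); rewrite mulrDr mulrCA.
Qed.

Lemma max_ideal_closed : idealr_closed max_ideal.
Proof. by apply: principal_idealr_closed => y; apply: OK_2nunit. Qed.
Lemma max_ideal_sq_closed : idealr_closed max_ideal_sq.
Proof. by apply: principal_idealr_closed => y; rewrite expr2 -mulrA OK_2nunit. Qed.
HB.instance Definition _ := isIdealr.Build OK max_ideal max_ideal_closed.
HB.instance Definition _ := isIdealr.Build OK max_ideal_sq max_ideal_sq_closed.

Definition residue_ring := {ideal_quot max_ideal}.
HB.instance Definition _ := GRing.ComNzRing.on residue_ring.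
Definition RK := {ideal_quot max_ideal_sq}.
HB.instance Definition _ := GRing.ComNzRing.on RK.

Definition to_residue : OK -> residue_ring := \pi_{ideal_quot max_ideal}%qT.
Definition to_RK : OK -> RK := \pi_{ideal_quot max_ideal_sq}%qT.

Definition field_trace (x : K) : Q2 :=
  \tr (passmx.mxof (vbasis {:K}) (vbasis {:K}) (amull x)).

(* the trace of an integral element lies in Z_2, so the default 0 is unused *)
Definition OK_trace (x : OK) : Z2 :=
  xget 0 [set z : Z2 | @tofrac Z2 z = field_trace (val x)].

(* well defined since Tr (x + 4 y) = Tr x + 4 Tr y; the second residue of an
   element of Z_2 is its class modulo 4 *)
Definition trR (r : RK) : 'Z_4 := inZp (OK_trace (repr r) 2%N).

End IntegerRing.

Definition psi (RR : realType) (K : fieldExtType Q2) (z : RK K) : RR[i] :=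
  let t := 2%:R * pi / 4%:R * (trR z : nat)%:R in (cos t +i* sin t)%C.

Section FreeModules.
Variables (A : comNzRingType) (W : lmodType A).

Definition free_of_rank (S : {pred W}) (m : nat) : Prop :=
  exists b : 'I_m -> W, (forall i, b i \in S) /\
    forall w, w \in S -> exists! c : 'rV[A]_m, w = \sum_i c 0 i *: b i.

Definition bilinear_form (omega : W -> W -> A) : Prop :=
  (forall u, scalar (omega u)) /\ (forall v, scalar (omega^~ v)).

(* over a ring, non-degenerate means that the adjoint W -> W^* is bijective *)
Definition symplectic_form (omega : W -> W -> A) : Prop :=
  [/\ bilinear_form omega, forall v, omega v v = 0 &
      forall f : {scalar W}, exists! u, forall v, f v = omega u v].

Definition lagrangian (omega : W -> W -> A) (S : {pred W}) : Prop :=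
  submod_closed S /\
  forall v, v \in S <-> (forall u, u \in S -> omega u v = 0).

End FreeModules.

(* (V~, omega~) with its splitting V~ = L~_0 x M~_0 *)
Record split_symplectic (K : fieldExtType Q2) (n : nat) := SplitSymplectic {
  ss_mod : lmodType (RK K);
  ss_form : ss_mod -> ss_mod -> RK K;
  ss_L : {pred ss_mod};
  ss_M : {pred ss_mod};
  ss_free : free_of_rank (predT : {pred ss_mod}) (2 * n);
  ss_symplectic : symplectic_form ss_form;
  ss_L_free : exists m, free_of_rank ss_L m;
  ss_M_free : exists m, free_of_rank ss_M m;
  ss_L_lagrangian : lagrangian ss_form ss_L;
  ss_M_lagrangian : lagrangian ss_form ss_M;
  ss_split : forall v, exists! lm : ss_mod * ss_mod,
    [/\ lm.1 \in ss_L, lm.2 \in ss_M & v = lm.1 + lm.2] }.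
Arguments ss_L {K n} s _.
Arguments ss_M {K n} s _.

Section ReductionMod2.
Variables (K : fieldExtType Q2) (W : lmodType (RK K)).

Definition twice_mem : {pred W} := fun w => `[< exists u : W, w = 2%:R *: u >].
Lemma twice_zmod_closed : zmod_closed twice_mem.
Proof.
split; first by apply/asboolP; exists 0; rewrite scaler0.
move=> _ _ /asboolP[u ->] /asboolP[v ->]; apply/asboolP.
by exists (u - v); rewrite scalerBr.
Qed.
HB.instance Definition _ := GRing.isZmodClosed.Build W twice_mem
  twice_zmod_closed.

Definition mod2 := (Quotient.quot twice_mem).
HB.instance Definition _ := GRing.Zmodule.on mod2.
Definition to_mod2 : W -> mod2 := \pi_(Quotient.quot twice_mem)%qT.
Definition lift2 : mod2 -> W := repr.

Lemma lift2K : cancel lift2 to_mod2. Proof. exact: reprK. Qed.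
Lemma to_mod2D : {morph to_mod2 : u v / u + v}.
Proof. by move=> u v; rewrite /to_mod2 raddfD. Qed.
Lemma to_mod2_eq u v : to_mod2 u = to_mod2 v <-> exists w, u - v = 2%:R *: w.
Proof.
rewrite /to_mod2; split => [/eqP|h]; first by rewrite -Quotient.idealrBE => /asboolP.
by apply/eqP; rewrite -Quotient.idealrBE; apply/asboolP.
Qed.

Lemma to_RK_is_zmod_morphism : zmod_morphism (@to_RK K).
Proof. by move=> a b; rewrite /to_RK raddfB. Qed.
Lemma to_RK_is_monoid_morphism : monoid_morphism (@to_RK K).
Proof. by split=> [|a b]; rewrite /to_RK (rmorph1, rmorphM). Qed.

Definition mod2_scale (c : residue_ring K) (x : mod2) : mod2 :=
  to_mod2 (to_RK (repr c) *: lift2 x).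

Lemma mod2_scaleE a u :
  mod2_scale (to_residue a) (to_mod2 u) = to_mod2 (to_RK a *: u).
Proof.
apply/to_mod2_eq; set a' := repr _; set u' := lift2 _.
have [b a'E] : exists b, a' - a = 2%:R * b.
  have : (a' == a %[mod {ideal_quot @max_ideal K}])%qT by rewrite reprK.
  by rewrite -Quotient.idealrBE => /asboolP.
have [w u'E] : exists w, u' - u = 2%:R *: w by apply/to_mod2_eq/lift2K.
exists (to_RK b *: u' + to_RK a *: w).
have -> : a' = a + 2%:R * b by rewrite -a'E addrC subrK.
have -> : to_RK (a + 2%:R * b) = to_RK a + 2%:R * to_RK b.
  by rewrite /to_RK rmorphD rmorphM rmorph_nat.
rewrite scalerDl -scalerA scalerDr addrAC -scalerBr u'E addrC; congr (_ + _).
by rewrite !scalerA mulrC.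
Qed.

Lemma residueP (c : residue_ring K) : exists a, c = to_residue a.
Proof. by exists (repr c); rewrite /to_residue reprK. Qed.
Lemma mod2P (x : mod2) : exists u, x = to_mod2 u.
Proof. by exists (lift2 x); rewrite lift2K. Qed.

Lemma mod2_scaleA a b x :
  mod2_scale a (mod2_scale b x) = mod2_scale (a * b) x.
Proof.
have [a0 ->] := residueP a; have [b0 ->] := residueP b; have [u ->] := mod2P x.
have -> : to_residue a0 * to_residue b0 = to_residue (a0 * b0).
  by rewrite /to_residue rmorphM.
by rewrite !mod2_scaleE scalerA; congr (to_mod2 (_ *: _)); rewrite /to_RK rmorphM.
Qed.
Lemma mod2_scale1 : left_id 1 mod2_scale.
Proof.
move=> x; have [u ->] := mod2P x.
have -> : 1 = to_residue (1 : OK K) by rewrite /to_residue rmorph1.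
by rewrite mod2_scaleE /to_RK rmorph1 scale1r.
Qed.
Lemma mod2_scaleDr : right_distributive mod2_scale +%R.
Proof.
move=> a x y; have [a0 ->] := residueP a.
have [u ->] := mod2P x; have [v ->] := mod2P y.
by rewrite -to_mod2D !mod2_scaleE scalerDr to_mod2D.
Qed.
Lemma mod2_scaleDl x : {morph mod2_scale^~ x : a b / a + b}.
Proof.
move=> a b; have [a0 ->] := residueP a; have [b0 ->] := residueP b.
have [u ->] := mod2P x.
have -> : to_residue a0 + to_residue b0 = to_residue (a0 + b0).
  by rewrite /to_residue rmorphD.
by rewrite !mod2_scaleE -to_mod2D -scalerDl /to_RK rmorphD.
Qed.
HB.instance Definition _ := GRing.Zmodule_isLmodule.Build (residue_ring K) mod2
  mod2_scaleA mod2_scale1 mod2_scaleDr mod2_scaleDl.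

End ReductionMod2.

Section LinearGroup.
Variables (A : nzRingType) (W : lmodType A).

Record GL := MkGL {
  gl_fun :> W -> W;
  gl_linear : linear gl_fun;
  gl_bij : bijective gl_fun }.

HB.instance Definition _ := gen_eqMixin GL.
HB.instance Definition _ := gen_choiceMixin GL.
HB.instance Definition _ (f : GL) :=
  GRing.isLinear.Build A W W *:%R (gl_fun f) (@gl_linear f).

Lemma gl_eq (f g : GL) : f =1 g -> f = g.
Proof.
case: f g => [f f1 f2] [g g1 g2] /= fg.
have {fg} E : f = g by apply: functional_extensionality_dep.
by subst g; congr MkGL; apply: Prop_irrelevance.
Qed.

Lemma gl_inv_ex (f : GL) : exists g, cancel f g /\ cancel g f.
Proof. by have [g fK gK] := gl_bij f; exists g. Qed.
Definition gl_inv_fun (f : GL) : W -> W := projT1 (cid (gl_inv_ex f)).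
Lemma gl_funK f : cancel (gl_fun f) (gl_inv_fun f).
Proof. exact: (proj1 (projT2 (cid (gl_inv_ex f)))). Qed.
Lemma gl_invK f : cancel (gl_inv_fun f) (gl_fun f).
Proof. exact: (proj2 (projT2 (cid (gl_inv_ex f)))). Qed.
Lemma gl_inv_linear f : linear (gl_inv_fun f).
Proof.
move=> a u v; apply: (can_inj (gl_funK f)).
by rewrite gl_linear !gl_invK.
Qed.

Lemma gl_id_linear : linear (@id W). Proof. by []. Qed.
Lemma gl_comp_linear (f g : GL) : linear (f \o g).
Proof. by move=> a u v /=; rewrite !gl_linear. Qed.

Definition gl_one := MkGL gl_id_linear (Bijective (frefl id) (frefl id)).
Definition gl_mul (f g : GL) :=
  MkGL (@gl_comp_linear f g) (bij_comp (gl_bij f) (gl_bij g)).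
Definition gl_inv (f : GL) :=
  MkGL (@gl_inv_linear f) (Bijective (@gl_invK f) (@gl_funK f)).

Lemma gl_mulA : associative gl_mul. Proof. by move=> f g h; apply: gl_eq. Qed.
Lemma gl_mul1g : left_id gl_one gl_mul. Proof. by move=> f; apply: gl_eq. Qed.
Lemma gl_mulg1 : right_id gl_one gl_mul. Proof. by move=> f; apply: gl_eq. Qed.
Lemma gl_mulVg : left_inverse gl_one gl_inv gl_mul.
Proof. by move=> f; apply: gl_eq => v /=; rewrite gl_funK. Qed.
Lemma gl_mulgV : right_inverse gl_one gl_inv gl_mul.
Proof. by move=> f; apply: gl_eq => v /=; rewrite gl_invK. Qed.
HB.instance Definition _ :=
  isGroup.Build GL gl_mulA gl_mul1g gl_mulg1 gl_mulVg gl_mulgV.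

End LinearGroup.

Section ProjectiveGroup.
Variables (F : fieldType) (H : lmodType F).

Definition proportional (f g : GL H) : bool :=
  `[< exists2 c : F, c != 0 & forall v, f v = c *: g v >].

Lemma proportional_equiv : equiv_class_of proportional.
Proof.
split.
- by move=> f; apply/asboolP; exists 1; [exact: oner_neq0|move=> v; rewrite scale1r].
- have sym f g : proportional f g -> proportional g f.
    move=> /asboolP[c c0 fg]; apply/asboolP; exists c^-1; first by rewrite invr_eq0.
    by move=> v; rewrite fg scalerA mulVf // scale1r.
  by move=> f g; apply/idP/idP; apply: sym.
- move=> g f h /asboolP[c c0 fg] /asboolP[d d0 gh]; apply/asboolP.
  by exists (c * d); [rewrite mulf_neq0|move=> v; rewrite fg gh scalerA].
Qed.
Canonical proportional_equiv_rel := EquivRelPack proportional_equiv.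
Canonical proportional_encModRel := defaultEncModRel proportional.

Definition PGL := {eq_quot proportional}%qT.
Definition to_PGL : GL H -> PGL := \pi_{eq_quot proportional}%qT.

End ProjectiveGroup.

Fact cocycle_shuffle (M : zmodType) (a b c x y z : M) :
  a + (b + c + x) + (y + z) = a + b + y + c + (z + x).
Proof.
rewrite !addrA [RHS]addrAC; congr (_ + _); rewrite [LHS]addrAC; congr (_ + _).
exact: addrAC.
Qed.

Fact sum_shuffle (M : zmodType) (x x1 x2 y y1 y2 : M) :
  x + y - (x1 + y1) - (x2 + y2) = x - x1 - x2 + (y - y1 - y2).
Proof. by rewrite !opprD (addrACA x) [LHS]addrACA. Qed.

Section HeisenbergAndSymplectic.
Variables (K : fieldExtType Q2) (n : nat) (D : split_symplectic K n).
Local Notation Vt := (ss_mod D).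
Local Notation V := (mod2 Vt).
Local Notation R := (RK K).

Definition ss_projL (v : Vt) : Vt := (projT1 (cid (ss_split v))).1.
Definition ss_projM (v : Vt) : Vt := (projT1 (cid (ss_split v))).2.

Lemma ss_projP v : [/\ ss_projL v \in ss_L D, ss_projM v \in ss_M D &
  v = ss_projL v + ss_projM v].
Proof. by case: (projT2 (cid (ss_split v))). Qed.

Lemma ss_proj_uniq l m : l \in ss_L D -> m \in ss_M D ->
  ss_projL (l + m) = l /\ ss_projM (l + m) = m.
Proof.
move=> hl hm; have [_ /(_ (l, m))] := projT2 (cid (ss_split (l + m))).
by rewrite /ss_projL /ss_projM => -> /=.
Qed.

Lemma ss_projD u v : ss_projL (u + v) = ss_projL u + ss_projL v /\
  ss_projM (u + v) = ss_projM u + ss_projM v.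
Proof.
have [ul um uE] := ss_projP u; have [vl vm vE] := ss_projP v.
rewrite {1 3}uE {1 3}vE addrACA; apply: ss_proj_uniq.
- by have [[_ h] _] := ss_L_lagrangian D; rewrite -[ss_projL u]scale1r h.
- by have [[_ h] _] := ss_M_lagrangian D; rewrite -[ss_projM u]scale1r h.
Qed.

Definition beta_lift (u v : Vt) : R := ss_form (ss_projL u) (ss_projM v).

Lemma beta_liftDl u u' v : beta_lift (u + u') v = beta_lift u v + beta_lift u' v.
Proof.
rewrite /beta_lift (ss_projD u u').1.
have [[_ h] _ _] := ss_symplectic D.
by rewrite -[ss_projL u in LHS]scale1r h mul1r.
Qed.
Lemma beta_liftDr u v v' : beta_lift u (v + v') = beta_lift u v + beta_lift u v'.
Proof.
rewrite /beta_lift (ss_projD v v').2.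
have [[h _] _ _] := ss_symplectic D.
by rewrite -[ss_projM v in LHS]scale1r h mul1r.
Qed.

(* [lift2] is an arbitrary section of V~ -> V; [omegaE] and [betaE] show that
   the choice does not matter. *)
Definition omega (x y : V) : R := 2%:R * ss_form (lift2 x) (lift2 y).
Definition beta (x y : V) : R := 2%:R * beta_lift (lift2 x) (lift2 y).

Lemma RK_4eq0 : 2%:R * 2%:R = 0 :> R.
Proof.
rewrite -(rmorph0 (\pi_{ideal_quot @max_ideal_sq K}%qT)).
rewrite -(rmorph_nat (\pi_{ideal_quot @max_ideal_sq K}%qT)) -rmorphM.
apply/eqP; rewrite -Quotient.idealrBE subr0; apply/asboolP.
by exists 1; rewrite mulr1 expr2.
Qed.

Lemma mod2_factors (f : Vt -> Vt -> R) u v :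
  (forall u u' v, f (u + u') v = f u v + f u' v) ->
  (forall u v v', f u (v + v') = f u v + f u v') ->
  2%:R * f (lift2 (to_mod2 u)) (lift2 (to_mod2 v)) = 2%:R * f u v.
Proof.
move=> fDl fDr.
have [a aE] : exists a, lift2 (to_mod2 u) - u = 2%:R *: a.
  by apply/to_mod2_eq/lift2K.
have [b bE] : exists b, lift2 (to_mod2 v) - v = 2%:R *: b.
  by apply/to_mod2_eq/lift2K.
have -> : lift2 (to_mod2 u) = u + (a + a).
  by rewrite -[a + a]mulr2n -scaler_nat -aE addrC subrK.
have -> : lift2 (to_mod2 v) = v + (b + b).
  by rewrite -[b + b]mulr2n -scaler_nat -bE addrC subrK.
have dbl (z : R) : 2%:R * (z + z) = 0.
  have -> : z + z = 2%:R * z by rewrite mulr_natl mulr2n.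
  by rewrite mulrA RK_4eq0 mul0r.
by rewrite fDl (fDl a) mulrDr dbl addr0 fDr (fDr u b) mulrDr dbl addr0.
Qed.

Lemma omegaE u v : omega (to_mod2 u) (to_mod2 v) = 2%:R * ss_form u v.
Proof.
have [[hr hl] _ _] := ss_symplectic D.
apply: mod2_factors => [a b c|a b c].
  by rewrite -[a in LHS]scale1r hl mul1r.
by rewrite -[b in LHS]scale1r hr mul1r.
Qed.

Lemma betaE u v : beta (to_mod2 u) (to_mod2 v) = 2%:R * beta_lift u v.
Proof. by apply: mod2_factors; [apply: beta_liftDl|apply: beta_liftDr]. Qed.

Lemma betaDl x x' y : beta (x + x') y = beta x y + beta x' y.
Proof.
have [u ->] := mod2P x; have [u' ->] := mod2P x'; have [v ->] := mod2P y.
by rewrite -(to_mod2D u u') (betaE _ v) (betaE u v) (betaE u' v) beta_liftDl mulrDr.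
Qed.
Lemma betaDr x y y' : beta x (y + y') = beta x y + beta x y'.
Proof.
have [u ->] := mod2P x; have [v ->] := mod2P y; have [v' ->] := mod2P y'.
by rewrite -(to_mod2D v v') (betaE u) (betaE u v) (betaE u v') beta_liftDr mulrDr.
Qed.
Lemma beta0l y : beta 0 y = 0.
Proof. by apply: (addrI (beta 0 y)); rewrite -betaDl !addr0. Qed.
Lemma beta0r x : beta x 0 = 0.
Proof. by apply: (addrI (beta x 0)); rewrite -betaDr !addr0. Qed.

Record Heis := MkHeis { heis_v : V; heis_z : R }.
HB.instance Definition _ := gen_eqMixin Heis.
HB.instance Definition _ := gen_choiceMixin Heis.

Definition heis_one := MkHeis 0 0.
Definition heis_mul (h1 h2 : Heis) := MkHeis (heis_v h1 + heis_v h2)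
  (heis_z h1 + heis_z h2 + beta (heis_v h1) (heis_v h2)).
Definition heis_inv (h : Heis) := MkHeis (- heis_v h)
  (- heis_z h + beta (heis_v h) (heis_v h)).

Lemma betaN_l x y : beta (- x) y = - beta x y.
Proof. by apply: (addIr (beta x y)); rewrite -betaDl !addNr beta0l. Qed.
Lemma betaN_r x y : beta x (- y) = - beta x y.
Proof. by apply: (addIr (beta x y)); rewrite -betaDr !addNr beta0r. Qed.

Lemma heis_mulA : associative heis_mul.
Proof.
move=> [u a] [v b] [w c]; rewrite /heis_mul /=; congr MkHeis.
  by rewrite addrA.
by rewrite betaDl betaDr cocycle_shuffle.
Qed.
Lemma heis_mul1g : left_id heis_one heis_mul.
Proof. by move=> [v z]; rewrite /heis_mul /= beta0l addr0 !add0r. Qed.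
Lemma heis_mulg1 : right_id heis_one heis_mul.
Proof. by move=> [v z]; rewrite /heis_mul /= beta0r !addr0. Qed.
Lemma heis_mulVg : left_inverse heis_one heis_inv heis_mul.
Proof.
move=> [v z]; rewrite /heis_mul /heis_inv /= betaN_l addNr; congr MkHeis.
by rewrite addrAC addrK addNr.
Qed.
Lemma heis_mulgV : right_inverse heis_one heis_inv heis_mul.
Proof.
move=> [v z]; rewrite /heis_mul /heis_inv /= betaN_r subrr; congr MkHeis.
by rewrite addrA addrK subrr.
Qed.
HB.instance Definition _ := isGroup.Build Heis
  heis_mulA heis_mul1g heis_mulg1 heis_mulVg heis_mulgV.

Definition sp_mem : {pred GL V} :=
  fun g => `[< forall x y, omega (g x) (g y) = omega x y >].
Lemma sp_mem_closed : group_closed sp_mem.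
Proof.
split=> [|f g /asboolP hf /asboolP hg]; first exact/asboolP.
apply/asboolP => x y /=; rewrite hf.
by rewrite -[in RHS](gl_invK g x) -[in RHS](gl_invK g y) hg.
Qed.

Definition Sp := {g : GL V | g \in sp_mem}.
HB.instance Definition _ := SubChoice.on Sp.
HB.instance Definition _ := SubChoice_isSubGroup.Build (GL V) sp_mem Sp sp_mem_closed.

Definition Sigma_set (g : Sp) : set (V -> R) := [set alpha | forall v1 v2,
  alpha (v1 + v2) - alpha v1 - alpha v2
    = beta (val g v1) (val g v2) - beta v1 v2].

Record ASp := MkASp {
  asp_g : Sp;
  asp_alpha : V -> R;
  asp_Sigma : Sigma_set asp_g asp_alpha }.
HB.instance Definition _ := gen_eqMixin ASp.
HB.instance Definition _ := gen_choiceMixin ASp.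

Lemma asp_eq (a b : ASp) :
  asp_g a = asp_g b -> asp_alpha a =1 asp_alpha b -> a = b.
Proof.
case: a b => [g a ha] [h b hb] /= gh ab.
have {ab} E : a = b by apply: functional_extensionality_dep.
by subst h b; congr MkASp; apply: Prop_irrelevance.
Qed.

Lemma asp_one_subproof : Sigma_set 1%g (fun=> 0).
Proof. by move=> v1 v2 /=; rewrite !subrr. Qed.
Lemma asp_mul_subproof (a b : ASp) : Sigma_set (asp_g a * asp_g b)%g
  (asp_alpha a \o val (asp_g b) \+ asp_alpha b).
Proof.
move=> v1 v2 /=.
have ha := asp_Sigma a (val (asp_g b) v1) (val (asp_g b) v2).
have hb := asp_Sigma b v1 v2.
rewrite -[RHS](subrKA (beta (val (asp_g b) v1) (val (asp_g b) v2))) -ha -hb.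
by rewrite linearD sum_shuffle.
Qed.
Lemma asp_inv_subproof (a : ASp) : Sigma_set (asp_g a)^-1%g
  (fun v => - asp_alpha a (val (asp_g a)^-1%g v)).
Proof.
move=> v1 v2 /=.
have := asp_Sigma a (val (asp_g a)^-1%g v1) (val (asp_g a)^-1%g v2).
rewrite -linearD /= !gl_invK => e.
rewrite -[RHS]opprB -e !opprD.
by rewrite !opprK.
Qed.

Definition asp_one := MkASp asp_one_subproof.
Definition asp_mul (a b : ASp) := MkASp (asp_mul_subproof a b).
Definition asp_inv (a : ASp) := MkASp (asp_inv_subproof a).

Lemma asp_mulA : associative asp_mul.
Proof. by move=> a b c; apply: asp_eq => [|v] /=; rewrite ?mulgA ?addrA. Qed.
Lemma asp_mul1g : left_id asp_one asp_mul.
Proof. by move=> a; apply: asp_eq => [|v] /=; rewrite ?mul1g ?add0r. Qed.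
Lemma asp_mulg1 : right_id asp_one asp_mul.
Proof. by move=> a; apply: asp_eq => [|v] /=; rewrite ?mulg1 ?addr0. Qed.
Lemma asp_mulVg : left_inverse asp_one asp_inv asp_mul.
Proof.
by move=> a; apply: asp_eq => [|v] /=; rewrite ?mulVg // gl_funK addNr.
Qed.
Lemma asp_mulgV : right_inverse asp_one asp_inv asp_mul.
Proof. by move=> a; apply: asp_eq => [|v] /=; rewrite ?mulgV // subrr. Qed.
HB.instance Definition _ := isGroup.Build ASp
  asp_mulA asp_mul1g asp_mulg1 asp_mulVg asp_mulgV.

Definition asp_act (a : ASp) (h : Heis) : Heis :=
  MkHeis (val (asp_g a) (heis_v h)) (heis_z h + asp_alpha a (heis_v h)).

End HeisenbergAndSymplectic.

Definition irreducible (F : fieldType) (G : groupType) (H : lmodType F)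
    (r : {multiplicative G -> GL H}) : Prop :=
  (exists v : H, v != 0) /\
  forall S : {pred H}, submod_closed S ->
    (forall g v, v \in S -> r g v \in S) ->
    (forall v, v \in S -> v = 0) \/ (forall v, v \in S).

Section Representations.
Variables (RR : realType) (K : fieldExtType Q2) (n : nat).
Variables (D : split_symplectic K n) (H : lmodType RR[i]).

Definition heisenberg_representation (r : {multiplicative Heis D -> GL H}) :=
  irreducible r /\
  forall (z : RK K) (v : H), r (MkHeis 0 z) v = psi RR z *: v.

(* When [r] is the Heisenberg representation the set below is a singleton
   (Stone-von Neumann and Schur), so the default value is unused. *)
Definition projective_rep (r : {multiplicative Heis D -> GL H}) (g : ASp D) :
    PGL H :=
  xget (to_PGL 1%g) [set P | exists2 A : GL H, P = to_PGL A &
    forall h, (A * r h * A^-1)%g = r (asp_act g h)].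

End Representations.

Section Mu4.
Variable F : fieldType.

Definition mu4 := {z : F | z ^+ 4 == 1}.
HB.instance Definition _ := SubChoice.on mu4.

Lemma mu4_one_subproof : (1 : F) ^+ 4 == 1. Proof. by rewrite expr1n. Qed.
Lemma mu4_mul_subproof (x y : mu4) : (val x * val y) ^+ 4 == 1.
Proof. by rewrite exprMn (eqP (valP x)) (eqP (valP y)) mulr1. Qed.
Lemma mu4_inv_subproof (x : mu4) : (val x)^-1 ^+ 4 == 1.
Proof. by rewrite exprVn (eqP (valP x)) invr1. Qed.
Lemma mu4_neq0 (x : mu4) : val x != 0.
Proof.
apply/eqP => x0; have := valP x.
by rewrite /= -[sval x]/(val x) x0 expr0n eq_sym oner_eq0.
Qed.

Definition mu4_one : mu4 :=
  exist (fun z : F => is_true (z ^+ 4 == 1)) 1 mu4_one_subproof.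
Definition mu4_mul (x y : mu4) : mu4 :=
  exist (fun z : F => is_true (z ^+ 4 == 1)) (val x * val y) (mu4_mul_subproof x y).
Definition mu4_inv (x : mu4) : mu4 :=
  exist (fun z : F => is_true (z ^+ 4 == 1)) (val x)^-1 (mu4_inv_subproof x).

Lemma mu4_mulA : associative mu4_mul.
Proof. by move=> x y z; apply: val_inj; rewrite /= mulrA. Qed.
Lemma mu4_mul1g : left_id mu4_one mu4_mul.
Proof. by move=> x; apply: val_inj; rewrite /= mul1r. Qed.
Lemma mu4_mulg1 : right_id mu4_one mu4_mul.
Proof. by move=> x; apply: val_inj; rewrite /= mulr1. Qed.
Lemma mu4_mulVg : left_inverse mu4_one mu4_inv mu4_mul.
Proof. by move=> x; apply: val_inj; rewrite /= mulVf // mu4_neq0. Qed.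
Lemma mu4_mulgV : right_inverse mu4_one mu4_inv mu4_mul.
Proof. by move=> x; apply: val_inj; rewrite /= mulfV // mu4_neq0. Qed.
HB.instance Definition _ := isGroup.Build mu4
  mu4_mulA mu4_mul1g mu4_mulg1 mu4_mulVg mu4_mulgV.

End Mu4.

Definition central_extension (A E G : groupType)
    (i : {multiplicative A -> E}) (p : {multiplicative E -> G}) : Prop :=
  [/\ injective i,
      forall g, exists x, p x = g,
      forall x, p x = 1%g <-> exists a, x = i a &
      forall a x, (i a * x = x * i a)%g].

(* Main.v *)
Require Import Defs.
From HB Require Import structures.
From mathcomp Require Import all_boot all_order all_algebra all_fingroup all_field.
From mathcomp Require Import generic_quotient ring_quotient complex.
From mathcomp Require Import boolp classical_sets reals trigo.
From mathcomp Require Import abelian zify ring.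
From Stdlib Require Import Btauto.

Set Implicit Arguments.
Unset Strict Implicit.
Unset Printing Implicit Defensive.

Import GRing.Theory Num.Theory.
Local Open Scope ring_scope.

(** Let W_v be the operator of (v, 0) in the Heisenberg representation. As beta
    takes its values in 2R, the operators W_v multiply up to signs, and the
    algebra that they span carries the involution A |-> A^* with
    W_v^* = W_v^-1 that is conjugate linear in the coefficients.

    Fix the coefficient ring O = Z[i, 1/2], and call A star-unitary if
    A = sum_v f(v) W_v with f : V -> O and A^-1 = A^*. The star-unitary operators
    form a group. A scalar c belongs to it only if c is in O and c c^* = 1, and
    then c is a fourth root of unity: clearing denominators gives integers with
    a^2 + b^2 = 4^k, and a descent modulo 4 shows that a or b vanishes
    ([dyadic_gauss_norm1], [star_pair_scalar]). Hence AMp(V) can be taken to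
    consist of the pairs (g, A) with A a star-unitary operator such that
    A pi(h) A^-1 = pi(g h): by Schur's lemma the kernel of (g, A) |-> g
    is mu_4, and it remains to lift every g in ASp(V).

    Given (g, alpha) in ASp(V), put a = psi o alpha. For each w in V the average
    A_w = sum_v a(v) W_(gv) W_w W_v^-1 satisfies the intertwining relation, and its
    coefficients lie in Z[i]. Orthogonality of the characters
    chi(v, -) = psi(omega(v, -)) gives
    A_w A_w^* = A_w^* A_w = |V| sum_(s in ker(g - 1)) a(s) chi(w, s).
    Summed over w the last sum equals |V|, so it is non-zero for some w; it
    is a sum of values of a character, so it is then |ker(g - 1)|. The vector space
    V has exponent 2, so |V| |ker(g - 1)| is a power 2^k, the norm of (1 + i)^k,
    and (1 + i)^-k A_w is a star-unitary lift ([weyl_intertwiner]).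

    This argument needs V to be finite and the signs psi(omega(u, v)) to be
    non-degenerate, and both come from the arithmetic of K. A maximal family in
    O_K that is independent modulo 2 is finite, because it is linearly independent
    over Q_2, and by 2-adic completeness it is a basis of O_K over Z_2. In this basis
    the trace of K reduces modulo 2 to the trace of the residue field k over F_2,
    which is x |-> sum_j x^(2^j): a non-zero polynomial of degree smaller than |k|,
    so some element of O_K has odd trace ([exists_odd_trace]). Since K is unramified,
    an element outside 2 O_K is a unit, and so an r with tr(r O_K) in 2 Z_2 lies in
    2 O_K ([even_trace_even]). *)

(** * The ring Z[i, 1/2] in an algebraically closed field *)

(** A square is 0 or 1 modulo 4, so for k > 0 both a and b are even and
    everything can be divided by 2; for k = 0 the claim is immediate. *)
Lemma sum_squares_pow4 (k : nat) (a b : int) :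
  a ^+ 2 + b ^+ 2 = (2%:R ^+ k) ^+ 2 -> a = 0 \/ b = 0.
Proof.
elim: k a b => [|k IH] a b; first by rewrite expr0; nia.
(* e and f are the parities of a and b; the equation forces both to be 0 *)
have [x [e ->]] : exists x (e : bool), a = 2 * x + e%:Z.
  exists (a %/ 2)%Z, ((a %% 2)%Z == 1); lia.
have [y [f ->]] : exists y (f : bool), b = 2 * y + f%:Z.
  exists (b %/ 2)%Z, ((b %% 2)%Z == 1); lia.
rewrite (exprS _ k); set p := 2%:R ^+ k => E.
(* modulo 4 the sum of the two parities vanishes *)
have {}E : 4 * (x ^+ 2 + x * e%:Z + y ^+ 2 + y * f%:Z - p ^+ 2) = - (e%:Z ^+ 2 + f%:Z ^+ 2).
  by apply/eqP; rewrite -subr_eq0; apply/eqP; move/eqP: E; rewrite -subr_eq0 => /eqP <-; ring.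
case: e f E => -[] E; try by exfalso; lia.
have /IH[->|->] : x ^+ 2 + y ^+ 2 = p ^+ 2 by lia.
  by left; rewrite mulr0.
by right; rewrite mulr0.
Qed.

Section DyadicGauss.
Variable C : numClosedFieldType.

Definition dyadic_gauss (x : C) : Prop :=
  exists (k : nat) (a b : int), 2%:R ^+ k * x = a%:~R + 'i * b%:~R.

Lemma dyadic_gaussD x y : dyadic_gauss x -> dyadic_gauss y -> dyadic_gauss (x + y).
Proof.
move=> [k [a [b E]]] [l [c [d E']]].
exists (k + l)%N, (2%:R ^+ l * a + 2%:R ^+ k * c), (2%:R ^+ l * b + 2%:R ^+ k * d).
rewrite !rmorphD !rmorphM !rmorphXn /= exprD.
transitivity (2%:R ^+ l * (2%:R ^+ k * x) + 2%:R ^+ k * (2%:R ^+ l * y)); first by ring.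
by rewrite E E' !rmorph_nat; ring.
Qed.

Lemma dyadic_gaussM x y : dyadic_gauss x -> dyadic_gauss y -> dyadic_gauss (x * y).
Proof.
move=> [k [a [b E]]] [l [c [d E']]].
exists (k + l)%N, (a * c - b * d), (a * d + b * c).
rewrite !rmorphD !rmorphM !rmorphN /= !rmorphM /= exprD mulrACA E E'.
have i2 : 'i * 'i = -1 :> C by rewrite -expr2 sqrCi.
transitivity (a%:~R * c%:~R + ('i * 'i) * (b%:~R * d%:~R)
  + 'i * (a%:~R * d%:~R + b%:~R * c%:~R) : C); first by ring.
by rewrite i2; ring.
Qed.

Lemma dyadic_gauss_conj x : dyadic_gauss x -> dyadic_gauss x^*.
Proof.
move=> [k [a [b E]]]; exists k, a, (- b); move/(congr1 Num.conj): E.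
rewrite !rmorphD !rmorphM !rmorphXn /= !rmorph_nat conjCi !rmorph_int => ->.
by rewrite rmorphN mulrN mulNr.
Qed.

Lemma dyadic_gauss_int (a : int) : dyadic_gauss a%:~R.
Proof. by exists 0%N, a, 0; rewrite expr0 mul1r mulr0 addr0. Qed.

Lemma dyadic_gauss_i : dyadic_gauss 'i.
Proof. by exists 0%N, 0, 1; rewrite expr0 mul1r mulr1 add0r. Qed.

Lemma dyadic_gaussX x k : dyadic_gauss x -> dyadic_gauss (x ^+ k).
Proof.
move=> Hx; elim: k => [|k IH]; first exact: (dyadic_gauss_int 1).
by rewrite exprS; apply: dyadic_gaussM.
Qed.

Lemma dyadic_gauss_fourth_root x : x ^+ 4 = 1 -> dyadic_gauss x.
Proof.
move=> x4.
have : (x ^+ 2 - 1) * (x ^+ 2 + 1) == 0.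
  by apply/eqP; transitivity (x ^+ 4 - 1); [ring|rewrite x4 subrr].
rewrite mulf_eq0 => /orP[].
  rewrite subr_eq0 sqrf_eq1 => /orP[] /eqP ->; first exact: (dyadic_gauss_int 1).
  exact: (dyadic_gauss_int (-1)).
rewrite addr_eq0 -sqrCi eqf_sqr => /orP[] /eqP ->; first exact: dyadic_gauss_i.
by rewrite -mulN1r; apply/dyadic_gaussM/dyadic_gauss_i; apply: (dyadic_gauss_int (-1)).
Qed.

(** This is why the kernel of the extension is mu_4: after clearing denominators,
    [sum_squares_pow4] leaves only real and purely imaginary elements. *)
Lemma dyadic_gauss_norm1 x : dyadic_gauss x -> x * x^* = 1 -> x ^+ 4 = 1.
Proof.
move=> [k [a [b E]]] x1.
have p0 : 2%:R ^+ k != 0 :> C by rewrite expf_neq0 // pnatr_eq0.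
have i2 : 'i * 'i = -1 :> C by rewrite -expr2 sqrCi.
have N : a ^+ 2 + b ^+ 2 = (2%:R ^+ k) ^+ 2.
  apply: (@intr_inj C); rewrite !rmorphD !rmorphXn /= rmorph_nat.
  have M := congr1 (fun z => z * z^*) E.
  rewrite /= rmorphM rmorphXn /= rmorph_nat mulrACA x1 mulr1 in M.
  rewrite [RHS]expr2 M rmorphD rmorphM /= conjCi !rmorph_int.
  transitivity (a%:~R ^+ 2 - ('i * 'i) * b%:~R ^+ 2 : C); last by ring.
  by rewrite i2; ring.
apply: (mulfI (expf_neq0 4 p0)); rewrite -exprMn E mulr1.
have [a0|b0] := sum_squares_pow4 N; subst.
  move: N; rewrite expr0n add0r => N.
  rewrite add0r exprMn -[4%N]/(2 * 2)%N !exprM sqrCi -(rmorphXn _ 2) N !rmorphXn /= rmorph_nat.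
  by rewrite sqrrN !expr1n mul1r.
move: N; rewrite [0 ^+ 2]expr0n addr0 => N.
by rewrite mulr0 addr0 -[4%N]/(2 * 2)%N !exprM -(rmorphXn _ 2) N !rmorphXn /= rmorph_nat.
Qed.

(** The element 1 + i has norm 2, so its powers normalise operators whose square
    norm is a power of 2 without leaving the coefficient ring. *)
Lemma dyadic_gauss_inv_1i : dyadic_gauss (1 + 'i)^-1.
Proof.
have i2 : 'i * 'i = -1 :> C by rewrite -expr2 sqrCi.
have E : (1 + 'i) * (1 - 'i) = 2%:R :> C.
  by transitivity (1 - 'i * 'i : C); [ring|rewrite i2; ring].
have n0 : 1 + 'i != 0 :> C.
  by apply/eqP => h; move/eqP: E; rewrite h mul0r eq_sym pnatr_eq0.
exists 1%N, 1, (-1); rewrite expr1 -E mulrAC mulfV // mul1r.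
by rewrite mulrN1.
Qed.

End DyadicGauss.

(** * Projective representations of elementary abelian 2-groups *)

Lemma addb_xorb x y : x (+) y = xorb x y. Proof. by case: x y => -[]. Qed.

(** Such a subset is an elementary abelian 2-group, to which Cauchy's theorem
    applies. *)
Lemma card_exponent2 (V : finZmodType) (F : {set V}) :
  (forall v : V, v + v = 0) -> 0 \in F -> {in F &, forall u v, u + v \in F} ->
  exists k, #|F| = (2 ^ k)%N.
Proof.
move=> VV F0 FD.
have gF : group_set F by apply/group_setP; split => // u v; apply: FD.
pose G := Group gF.
have : (2%N.-abelem G)%g.
  apply/abelemP => //; split.
    by apply/centsP => x _ y _; apply: (addrC x y).
  by move=> x _; rewrite expgS expg1; apply: VV.
by move=> /abelem_pgroup /p_natP[k E]; exists k.
Qed.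

Section WeylSystem.
Variables (C : numClosedFieldType) (V : finZmodType) (H : lmodType C).
Variables (W : V -> {linear H -> H}) (b : V -> V -> bool).
Local Notation sg e := ((-1) ^+ (e : bool) : C).
Hypothesis W0 : forall x, W 0 x = x.
Hypothesis WM : forall u v x, W u (W v x) = sg (b u v) *: W (u + v) x.
Hypothesis bDl : forall u u' v, b (u + u') v = b u v (+) b u' v.
Hypothesis bDr : forall u v v', b u (v + v') = b u v (+) b u v'.
Hypothesis VV : forall v : V, v + v = 0.
Hypothesis b_nondeg : forall t, (forall v, b v t = b t v) -> t = 0.

(** The coefficients of the adjoint: W_v^-1 = (-1)^(b v v) W_v, because 2v = 0. *)
Definition weyl_adjoint (f : V -> C) v := (f v)^* * sg (b v v).

(** The relation B = A^* for operators with coefficients in Z[i, 1/2]. It is a relation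
    between functions, so that no uniqueness of the coefficients of A has to be
    established before A^* can be used. *)
Definition star_pair (A B : H -> H) := exists f : V -> C,
  [/\ forall v, dyadic_gauss (f v), forall x, A x = \sum_v f v *: W v x &
      forall x, B x = \sum_v weyl_adjoint f v *: W v x].

Lemma conj_sign e : (sg e)^* = sg e.
Proof. by rewrite rmorphXn /= rmorphN rmorph1. Qed.

Lemma dyadic_gauss_sign e : dyadic_gauss (sg e).
Proof. by apply: dyadic_gaussX; apply: (dyadic_gauss_int _ (-1)). Qed.

Lemma star_pair_ext A B A' B' : A =1 A' -> B =1 B' -> star_pair A B -> star_pair A' B'.
Proof.
by move=> eA eB [f [h1 h2 h3]]; exists f; split => // x; rewrite -?eA -?eB.
Qed.

Lemma star_pair_sum (I : Type) (r : seq I) (A B : I -> H -> H) :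
  (forall i, star_pair (A i) (B i)) ->
  star_pair (fun x => \sum_(i <- r) A i x) (fun x => \sum_(i <- r) B i x).
Proof.
move=> AB; elim: r => [|i r [f [h1 h2 h3]]].
  exists (fun=> 0); split=> [v|x|x]; first exact: (dyadic_gauss_int _ 0).
    by rewrite big_nil big1 // => v _; rewrite scale0r.
  by rewrite big_nil big1 // => v _; rewrite /weyl_adjoint rmorph0 mul0r scale0r.
have [g [k1 k2 k3]] := AB i; exists (fun v => g v + f v); split=> [v|x|x].
- exact: dyadic_gaussD.
- by rewrite big_cons h2 k2 -big_split; apply: eq_bigr => v _; rewrite scalerDl.
- rewrite big_cons h3 k3 -big_split; apply: eq_bigr => v _.
  by rewrite /weyl_adjoint rmorphD mulrDl scalerDl.
Qed.

Lemma star_pair_term a w : dyadic_gauss a ->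
  star_pair (fun x => a *: W w x) (fun x => (a^* * sg (b w w)) *: W w x).
Proof.
move=> Ha; exists (fun v => a *+ (v == w)); split=> [v|x|x].
- by case: eqP => _ //; rewrite mulr0n; exact: (dyadic_gauss_int _ 0).
- rewrite (bigD1 w) //= eqxx big1 ?addr0 // => v /negPf ->.
  by rewrite mulr0n scale0r.
- rewrite (bigD1 w) //= /weyl_adjoint eqxx big1 ?addr0 // => v /negPf ->.
  by rewrite mulr0n rmorph0 mul0r scale0r.
Qed.

Lemma form0l v : b 0 v = false.
Proof. by have := bDl 0 0 v; rewrite addr0 => ->; rewrite addbb. Qed.
Lemma form0r v : b v 0 = false.
Proof. by have := bDr v 0 0; rewrite addr0 => ->; rewrite addbb. Qed.

(** The adjoint reverses products. It suffices to compare the terms of the expanded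
    double sums, where both sides are multiples of W_(u+v). *)
Lemma star_pair_mul A B A' B' : star_pair A B -> star_pair A' B' ->
  star_pair (A \o A') (B' \o B).
Proof.
move=> [f [f1 f2 f3]] [g [g1 g2 g3]].
pose h u v := f u * g v * sg (b u v).
have hP u v : dyadic_gauss (h u v).
  by apply: dyadic_gaussM; [apply: dyadic_gaussM|apply: dyadic_gauss_sign].
apply: star_pair_ext (star_pair_sum (index_enum V) (fun u =>
  star_pair_sum (index_enum V) (fun v => star_pair_term (u + v) (hP u v)))).
- move=> x; rewrite /= f2; apply: eq_bigr => u _; rewrite g2 linear_sum scaler_sumr.
  by apply: eq_bigr => v _; rewrite linearZ /= WM !scalerA.
- move=> x; rewrite /= g3 exchange_big; apply: eq_bigr => v _; rewrite f3 linear_sum scaler_sumr.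
  apply: eq_bigr => u _; rewrite linearZ /= WM !scalerA addrC; congr (_ *: _).
  rewrite /weyl_adjoint /h !rmorphM /= conj_sign !bDl !bDr !signr_addb.
  by case: (b u v) (b v u) => -[] /=; rewrite ?expr0 ?expr1; ring.
Qed.

Lemma star_pair_sym A B : star_pair A B -> star_pair B A.
Proof.
move=> [f [f1 f2 f3]]; exists (weyl_adjoint f); split => // [v|x].
  by apply: dyadic_gaussM; [apply: dyadic_gauss_conj|apply: dyadic_gauss_sign].
rewrite f2; apply: eq_bigr => v _; rewrite /weyl_adjoint rmorphM /= conjCK conj_sign.
by rewrite -mulrA -signr_addb addbb mulr1.
Qed.

Lemma star_pair_id : star_pair id id.
Proof.
apply: star_pair_ext (star_pair_term 0 (dyadic_gauss_int C 1)) => x.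
  by rewrite W0 scale1r.
by rewrite W0 form0l mulr1 rmorph1 scale1r.
Qed.

Lemma star_pair_scale a A B : dyadic_gauss a -> star_pair A B ->
  star_pair (fun x => a *: A x) (fun x => a^* *: B x).
Proof.
move=> Ha [f [f1 f2 f3]]; exists (fun v => a * f v); split=> [v|x|x].
- exact: dyadic_gaussM.
- by rewrite f2 scaler_sumr; apply: eq_bigr => v _; rewrite scalerA.
- rewrite f3 scaler_sumr; apply: eq_bigr => v _.
  by rewrite /weyl_adjoint rmorphM scalerA mulrA.
Qed.

(** The commutator of W_u and W_v. *)
Definition comm_sign u v : C := sg (b u v (+) b v u).

(** Orthogonality: if t is not 0, non-degeneracy provides u with comm_sign u t = -1,
    and translating the summation variable by u changes the sign of the sum. *)
Lemma comm_sign_sum t : \sum_v comm_sign v t = (if t == 0 then #|V|%:R else 0).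
Proof.
case: eqP => [->|t0].
  by rewrite -sumr_const; apply: eq_bigr => v _; rewrite /comm_sign form0l form0r.
have [u Hu] : exists u, b u t != b t u.
  apply/existsP; apply: contra_notT t0 => /existsPn h; apply: b_nondeg => v.
  by apply/eqP/negPn/h.
have E : \sum_v comm_sign v t = - \sum_v comm_sign v t.
  rewrite {1}(reindex_inj (addIr u)) -sumrN; apply: eq_bigr => v _.
  rewrite /comm_sign bDl bDr; case: (b u t) (b t u) Hu => -[] //= _; case: (b v t) (b t v) => -[];
  by rewrite /= ?expr0 ?expr1 ?opprK.
apply/eqP; have : (\sum_v comm_sign v t) *+ 2 == 0 by rewrite mulr2n {1}E addNr.
by rewrite mulrn_eq0.
Qed.

(** A scalar e = sum_v g(v) W_v must equal g(0): averaging over the conjugates by all W_u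
    kills the terms with v != 0 by orthogonality. Applied to a and a', this
    turns the relation between operators into one between scalars. *)
Lemma star_pair_scalar (h : H) a a' : h != 0 ->
  star_pair (fun x => a *: x) (fun x => a' *: x) -> dyadic_gauss a /\ a' = a^*.
Proof.
move=> h0 [f [f1 f2 f3]].
have V0 : #|V|%:R != 0 :> C.
  by rewrite pnatr_eq0 -lt0n; apply/card_gt0P; exists 0.
have key (g : V -> C) (e : C) : (forall x, e *: x = \sum_v g v *: W v x) -> e = g 0.
  move=> E; apply: (mulfI V0); apply/eqP; rewrite -subr_eq0.
  suff : (#|V|%:R * e - #|V|%:R * g 0) *: h == 0 by rewrite scaler_eq0 (negPf h0) orbF.
  rewrite scalerBl subr_eq0; apply/eqP.
  (* the scalar e commutes with each W_u, whose inverse is sg (b u u) *: W u *)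
  transitivity (\sum_u sg (b u u) *: W u (e *: W u h)).
    rewrite -sumr_const mulr_suml scaler_suml; apply: eq_bigr => u _.
    by rewrite mul1r linearZ /= WM VV W0 !scalerA mulrAC -signr_addb addbb mul1r.
  transitivity (\sum_u \sum_v (g v * comm_sign u v) *: W v h).
    apply: eq_bigr => u _; rewrite E linear_sum scaler_sumr; apply: eq_bigr => v _.
    rewrite linearZ /= 2!WM !scalerA addrAC VV add0r.
    congr (_ *: _); rewrite bDl [_ * g v]mulrC -!mulrA -!signr_addb; congr (_ * sg _).
    by rewrite !addb_xorb; btauto.
  rewrite exchange_big (bigD1 0) //= [X in _ + X]big1 => [|v /negPf v0].
    by rewrite addr0 -scaler_suml -mulr_sumr comm_sign_sum eqxx W0 mulrC.
  by rewrite -scaler_suml -mulr_sumr comm_sign_sum v0 mulr0 scale0r.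
have -> := key _ _ f3; have -> := key _ _ f2; split => //.
by rewrite /weyl_adjoint form0l mulr1.
Qed.

Section Intertwiner.
(** The rule W_v |-> a(v) W_(Tv) is compatible with the products of the W_v: this is
    what [aD] expresses. *)
Variables (T : V -> V) (a : V -> C).
Hypothesis TD : forall u v, T (u + v) = T u + T v.
Hypothesis Tinj : injective T.
Hypothesis aD : forall u v, a (u + v) = a u * a v * sg (b (T u) (T v) (+) b u v).
Hypothesis a4 : forall v, a v ^+ 4 = 1.

Let shift s := T s + s.

Lemma twist_map0 : T 0 = 0. Proof. by apply: (addrI (T 0)); rewrite -TD !addr0. Qed.

Lemma twist_neq0 v : a v != 0.
Proof.
by apply/eqP => h; have := a4 v; rewrite h expr0n => /esym/eqP; rewrite oner_eq0.
Qed.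

Lemma twist0 : a 0 = 1.
Proof.
apply: (mulfI (twist_neq0 0)); have := aD 0 0.
by rewrite addr0 twist_map0 addbb !mulr1 => <-.
Qed.

Lemma twist_norm1 v : a v * (a v)^* = 1.
Proof.
have : `|a v| ^+ 4 = 1 by rewrite -normrX a4 normr1.
by move/eqP; rewrite pexprn_eq1 //= => /eqP h; rewrite -normCK h expr1n.
Qed.

(** The left side of [aD] is symmetric in u and v, hence so is its right side: T
    preserves the commutator form. *)
Lemma twist_symplectic u v : b (T u) (T v) = b (T v) (T u) (+) b u v (+) b v u.
Proof.
have := aD u v; rewrite addrC aD [a v * a u]mulrC => /(mulfI (mulf_neq0 (twist_neq0 _) (twist_neq0 _))).
by move=> /signr_inj; case: (b (T u) _) (b (T v) _) (b u v) (b v u) => -[] [] [].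
Qed.

(** The average over v of a(v) W_(Tv) W_w W_v^-1 has, after multiplying out, the term
    avg_coef w v times W at avg_index w v = Tv + w + v. *)
Definition avg_coef w v : C := a v * sg (b v v (+) b w v (+) b (T v) w (+) b (T v) v).
Definition avg_index w v := T v + (w + v).

Lemma avg_coef_norm1 w v : avg_coef w v * (avg_coef w v)^* = 1.
Proof. by rewrite /avg_coef rmorphM /= conj_sign mulrACA twist_norm1 -signr_addb addbb mulr1. Qed.

Lemma avg_coef_dyadic w v : dyadic_gauss (avg_coef w v).
Proof.
apply: dyadic_gaussM; last exact: dyadic_gauss_sign.
exact: dyadic_gauss_fourth_root.
Qed.

Lemma avg_coefD w v s : avg_coef w (v + s) = avg_coef w v * avg_coef w s *
  sg (b (T v) (T s) (+) b s v (+) b (T v) s (+) b (T s) v).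
Proof.
rewrite /avg_coef aD !TD !bDl !bDr mulrACA -!mulrA -!signr_addb; congr (_ * (_ * _)).
by congr (sg _); rewrite !addb_xorb; btauto.
Qed.

Definition avg w (x : H) : H := \sum_v avg_coef w v *: W (avg_index w v) x.
Definition avg_adj w (x : H) : H :=
  \sum_v ((avg_coef w v)^* * sg (b (avg_index w v) (avg_index w v))) *: W (avg_index w v) x.

Lemma avg_star w : star_pair (avg w) (avg_adj w).
Proof. by apply: star_pair_sum => v; apply/star_pair_term/avg_coef_dyadic. Qed.

(** Replacing v by v + u in the sum turns W_v^-1 W_u into W_(v+u)^-1 up to the cocycle,
    which is absorbed by the functional equation of a. *)
Lemma avg_intertwines w u x : avg w (W u x) = a u *: W (T u) (avg w x).
Proof.
rewrite /avg (reindex_inj (addIr u)) linear_sum scaler_sumr; apply: eq_bigr => v _.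
rewrite linearZ /= !WM !scalerA.
have -> : avg_index w (v + u) + u = T u + avg_index w v.
  by rewrite /avg_index TD -!addrA VV addr0 addrCA.
congr (_ *: _); rewrite /avg_coef /avg_index aD !TD !bDl !bDr -!mulrA -!signr_addb.
rewrite mulrCA; congr (_ * (_ * _)).
rewrite [b (T u) (T v)]twist_symplectic; congr (sg _).
by rewrite !addb_xorb; btauto.
Qed.

Lemma avg_indexD w v s : avg_index w (v + s) = avg_index w v + shift s.
Proof.
rewrite /avg_index /shift TD -!addrA; congr (_ + _).
transitivity (w + (T s + (v + s))); first exact: addrCA.
by congr (_ + _); apply: addrCA.
Qed.

Lemma shift_eq0 s : shift s = 0 -> T s = s.
Proof. by move=> h; apply: (addIr s); rewrite VV. Qed.

Definition fixed_vectors := [set s | shift s == 0].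

(** The double sums for A A^* and A^* A both have this shape, where v and v + s are the
    indices of the two factors; the sum over v selects the s fixed by T. *)
Lemma twisted_sum w (g : V -> C) (S : V -> V) x : injective S ->
    (forall s, shift s = 0 -> g s = avg_coef w s) ->
  \sum_s \sum_v (g s * comm_sign (S v) (shift s)) *: W (shift s) x =
  (#|V|%:R * \sum_(s in fixed_vectors) a s * comm_sign w s) *: x.
Proof.
move=> Sinj gE; have sumS u : \sum_v comm_sign (S v) u = if u == 0 then #|V|%:R else 0.
  by rewrite -comm_sign_sum [RHS](reindex_inj Sinj).
rewrite (bigID (mem fixed_vectors)) /= [X in _ + X]big1 ?addr0 => [|s]; last first.
  rewrite inE => /negPf h; rewrite -scaler_suml -mulr_sumr.
  by rewrite sumS h mulr0 scale0r.
rewrite mulr_sumr scaler_suml; apply: eq_bigr => s; rewrite inE => /eqP h.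
rewrite -scaler_suml -mulr_sumr h W0 sumS eqxx mulrC gE //.
congr (_ * _ *: _); rewrite /avg_coef (shift_eq0 h) /comm_sign; congr (_ * sg _).
by rewrite !addb_xorb; btauto.
Qed.

Lemma avgK w x : avg w (avg_adj w x) =
  (#|V|%:R * \sum_(s in fixed_vectors) a s * comm_sign w s) *: x.
Proof.
rewrite -(@twisted_sum w (fun s => avg_coef w s * sg (b (shift s) w)) T) // => [|s ->]; last first.
  by rewrite form0l mulr1.
rewrite /avg /avg_adj [RHS]exchange_big /=.
under eq_bigr => v _ do rewrite linear_sum scaler_sumr.
rewrite exchange_big; apply: eq_bigr => v _; rewrite (reindex_inj (addrI v)).
apply: eq_bigr => s _; rewrite linearZ /= WM !scalerA avg_indexD.
rewrite (addrAC (avg_index w v) (shift s)) (VV (avg_index w v)) add0r.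
congr (_ *: _); rewrite avg_coefD [LHS](_ : _ = avg_coef w v * (avg_coef w v)^* * (avg_coef w s *
  (sg (b (T v) (T s) (+) b s v (+) b (T v) s (+) b (T s) v) * sg (b (avg_index w v) (avg_index w v)) *
   sg (b (avg_index w v + shift s) (avg_index w v))))); last by ring.
rewrite avg_coef_norm1 mul1r -!mulrA -!signr_addb; congr (_ * sg _).
by rewrite /avg_index /shift !bDl !bDr !addb_xorb; btauto.
Qed.

Lemma avg_adjK w x : avg_adj w (avg w x) =
  (#|V|%:R * \sum_(s in fixed_vectors) a s * comm_sign w s) *: x.
Proof.
rewrite -(@twisted_sum w (fun s => avg_coef w s * sg (b w (shift s))) id) // => [|s ->]; last first.
  by rewrite form0r mulr1.
rewrite /avg /avg_adj [RHS]exchange_big /=.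
apply: eq_bigr => v _; rewrite linear_sum scaler_sumr (reindex_inj (addrI v)).
apply: eq_bigr => s _; rewrite linearZ /= WM !scalerA avg_indexD.
rewrite (addrA (avg_index w v) (avg_index w v)) (VV (avg_index w v)) add0r.
congr (_ *: _); rewrite avg_coefD [LHS](_ : _ = avg_coef w v * (avg_coef w v)^* * (avg_coef w s *
  (sg (b (T v) (T s) (+) b s v (+) b (T v) s (+) b (T s) v) * sg (b (avg_index w v) (avg_index w v)) *
   sg (b (avg_index w v) (avg_index w v + shift s))))); last by ring.
rewrite avg_coef_norm1 mul1r -!mulrA -!signr_addb; congr (_ * sg _).
by rewrite /avg_index /shift !bDl !bDr !addb_xorb; btauto.
Qed.

Lemma fixed_vectors0 : 0 \in fixed_vectors.
Proof. by rewrite inE /shift twist_map0 addr0. Qed.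

Lemma fixed_vectorsD : {in fixed_vectors &, forall u v, u + v \in fixed_vectors}.
Proof.
move=> u v; rewrite !inE /shift TD addrACA => /eqP -> /eqP ->.
by rewrite addr0.
Qed.

(** Summing over w first leaves only s = 0 and gives |V|, so some w has a non-zero sum.
    On the vectors fixed by T the summand is multiplicative in s, and a non-zero sum of
    the values of a character means that the character is trivial. *)
Lemma exists_twist : exists w, \sum_(s in fixed_vectors) a s * comm_sign w s = #|fixed_vectors|%:R.
Proof.
have V0 : #|V|%:R != 0 :> C.
  by rewrite pnatr_eq0 -lt0n; apply/card_gt0P; exists 0.
have tot : \sum_w \sum_(s in fixed_vectors) a s * comm_sign w s = #|V|%:R.
  rewrite exchange_big (bigD1 0) ?fixed_vectors0 //= [X in _ + X]big1 => [|s /andP[_ /negPf s0]].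
    by rewrite addr0 -mulr_sumr comm_sign_sum eqxx twist0 mul1r.
  by rewrite -mulr_sumr comm_sign_sum s0 mulr0.
have [w Sw] : exists w, \sum_(s in fixed_vectors) a s * comm_sign w s != 0.
  apply/existsP; apply: contraT => /existsPn h.
  by move: V0; rewrite -tot big1 ?eqxx // => w _; apply/eqP/negPn/h.
exists w; rewrite -sumr_const; apply: eq_bigr => s sF.
apply: (mulIf Sw); rewrite mul1r [RHS](reindex_inj (addrI s)) mulr_sumr.
apply: eq_big => [u|u uF].
  apply/idP/idP => uF; first exact: fixed_vectorsD.
  by rewrite -[u]add0r -(VV s) -addrA fixed_vectorsD.
have Ts : T s = s by apply: shift_eq0; move: sF; rewrite inE => /eqP.
have Tu : T u = u by apply: shift_eq0; move: uF; rewrite inE => /eqP.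
rewrite aD Ts Tu addbb mulr1 mulrACA; congr (_ * _).
rewrite /comm_sign -signr_addb bDl bDr; congr (sg _).
by rewrite !addb_xorb; btauto.
Qed.

(** The operator is the average for a suitable w divided by (1 + i)^k, where
    2^k = |V| |ker(T - 1)| is the square norm of the average: (1 + i)^k has the same
    square norm and is invertible in Z[i, 1/2]. *)
Lemma weyl_intertwiner : exists A B : H -> H,
  [/\ linear A, cancel A B, cancel B A, star_pair A B &
      forall u x, A (W u x) = a u *: W (T u) (A x)].
Proof.
have [w Ew] := exists_twist.
have [k Ek] : exists k, (#|V| * #|fixed_vectors|)%N = (2 ^ k)%N.
  have [k1 E1] := card_exponent2 VV fixed_vectors0 fixed_vectorsD.
  have [k2 E2] : exists k, #|[set: V]| = (2 ^ k)%N by apply: card_exponent2 => [||u v] //; rewrite !inE.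
  by exists (k2 + k1)%N; rewrite expnD -E1 -E2 cardsT.
(* l is (1 + i)^-k, so that l l^* = 2^-k *)
pose l : C := (1 + 'i)^-1 ^+ k.
have lN : l * l^* * (#|V|%:R * #|fixed_vectors|%:R) = 1.
  have i2 : 'i * 'i = -1 :> C by rewrite -expr2 sqrCi.
  have E : (1 + 'i) * (1 - 'i) = 2%:R :> C.
    by transitivity (1 - 'i * 'i : C); [ring|rewrite i2; ring].
  rewrite -natrM Ek natrX /l rmorphXn /= fmorphV rmorphD /= rmorph1 conjCi.
  by rewrite -!exprMn -invfM E mulVf ?expr1n ?pnatr_eq0.
exists (fun x => l *: avg w x), (fun x => l^* *: avg_adj w x); split.
- move=> c x y; rewrite /avg !scaler_sumr -big_split; apply: eq_bigr => v _ /=.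
  by rewrite linearP /= !scalerDr !scalerA; congr (_ *: _ + _); ring.
- move=> x; have [f [f1 f2 f3]] := avg_star w.
  have -> : avg_adj w (l *: avg w x) = l *: avg_adj w (avg w x).
    by rewrite !f3 scaler_sumr; apply: eq_bigr => v _; rewrite linearZ /= !scalerA mulrC.
  by rewrite avg_adjK Ew !scalerA [l^* * l]mulrC lN scale1r.
- move=> x; have [f [f1 f2 f3]] := avg_star w.
  have -> : avg w (l^* *: avg_adj w x) = l^* *: avg w (avg_adj w x).
    by rewrite !f2 scaler_sumr; apply: eq_bigr => v _; rewrite linearZ /= !scalerA mulrC.
  by rewrite avgK Ew !scalerA lN scale1r.
- apply: star_pair_scale (avg_star w).
  by apply/dyadic_gaussX/dyadic_gauss_inv_1i.
- by move=> u x; rewrite avg_intertwines [in RHS]linearZ /= !scalerA mulrC.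
Qed.

End Intertwiner.
End WeylSystem.

(** * Eigenvectors of operators on a finitely spanned space *)

(** As the family y may have relations, T is only covered by a matrix M acting on
    coordinates. By Cayley-Hamilton a product of factors M - a annihilates the coordinates
    of h, and the first factor that kills the image in H reveals an eigenvector. *)
Lemma spanned_eigenvector (C : closedFieldType) (H : lmodType C) (m : nat)
    (y : 'I_m -> H) (T : {linear H -> H}) (h : H) :
  h != 0 -> (forall x, exists f : 'I_m -> C, x = \sum_i f i *: y i) ->
  exists a v, v != 0 /\ T v = a *: v.
Proof.
case: m y => [|m] y h0 ysp.
  by have [f hE] := ysp h; rewrite hE big_ord0 eqxx in h0.
have [M ME] : exists M : 'M[C]_m.+1, forall i, T (y i) = \sum_j M i j *: y j.
  have [f fE] : exists f : 'I_m.+1 -> 'I_m.+1 -> C, forall i, T (y i) = \sum_j f i j *: y j.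
    apply: (@fin_all_exists _ _ (fun i f => T (y i) = \sum_j f j *: y j)) => i.
    exact: ysp.
  by exists (\matrix_(i, j) f i j) => i; rewrite fE; apply: eq_bigr => j _; rewrite mxE.
pose phi (u : 'rV[C]_m.+1) := \sum_i u 0 i *: y i.
have phiM u : T (phi u) = phi (u *m M).
  rewrite linear_sum; under eq_bigr => i _ do rewrite linearZ /= ME scaler_sumr.
  rewrite exchange_big; apply: eq_bigr => j _; rewrite mxE scaler_suml.
  by apply: eq_bigr => i _; rewrite scalerA.
have phiB u a : phi (u *m (M - a%:M)) = T (phi u) - a *: phi u.
  rewrite phiM mulmxBr mul_mx_scalar /phi scaler_sumr -sumrB.
  by apply: eq_bigr => i _; rewrite !mxE scalerBl scalerA.
have [f hE] := ysp h; pose u0 := \row_i f i.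
have u0h : phi u0 = h by rewrite hE; apply: eq_bigr => i _; rewrite mxE.
have roots (s : seq C) u : phi u != 0 -> phi (u *m \prod_(a <- s) (M - a%:M)) = 0 ->
    exists a v, v != 0 /\ T v = a *: v.
  elim: s u => [|a s IH] u u_neq0; first by rewrite big_nil mulmx1 => /eqP; rewrite (negPf u_neq0).
  rewrite big_cons mulmxA; have [/eqP|] := eqVneq (phi (u *m (M - a%:M))) 0; last exact: IH.
  by rewrite phiB subr_eq0 => /eqP Tu _; exists a, (phi u).
have [s sE] := closed_field_poly_normal (char_poly M).
rewrite (monicP (char_poly_monic M)) scale1r in sE.
apply: (roots s u0); first by rewrite u0h.
have := Cayley_Hamilton M; rewrite sE rmorph_prod /=.
under eq_bigr => a _ do rewrite rmorphB /= horner_mx_X horner_mx_C.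
move=> ->; rewrite mulmx0 /phi big1 // => i _.
by rewrite mxE scale0r.
Qed.

(** * The 2-adic integers and their field of fractions *)

Section Dyadic.
Implicit Types x y z : Z2.

Lemma dyadic_addE x y n : (x + y) n = ((x n + y n) %% 2 ^ n)%N.
Proof. by []. Qed.

Lemma dyadic_mulE x y n : (x * y) n = ((x n * y n) %% 2 ^ n)%N.
Proof. by []. Qed.

Lemma dyadic_natE k n : (k%:R : Z2) n = (k %% 2 ^ n)%N.
Proof.
elim: k => [|k IH]; first by [].
by rewrite -addn1 natrD dyadic_addE IH [(1%:R : Z2) n](_ : _ = 1 %% 2 ^ n)%N // modnDm.
Qed.

Lemma dyadic_half x : x 1%N = 0%N -> exists y, x = 2%:R * y.
Proof.
move=> x1.
have even n : (2 %| x n.+1)%N by rewrite /dvdn -(expn1 2) dyadic_le // x1.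
have H n : x n.+1 %/ 2 = x n.+2 %/ 2 %[mod 2 ^ n].
  by rewrite {1}(dyadicP x n.+1) expnS divn_modl ?dvdn_mulr // mulKn // modn_mod.
exists (dyadic_of H); apply: dyadic_eq => n.
rewrite dyadic_mulE dyadic_natE [dyadic_of H n](_ : _ = (x n.+1 %/ 2) %% 2 ^ n)%N //.
rewrite modnMm modn_mod mulnC divnK //.
exact: dyadicS.
Qed.

(** All that is used later of the odd factor is its form 1 + 2t, which cannot become
    divisible by 2 in an integral extension. *)
Lemma dyadic_neq0_factor x : x != 0 ->
  exists k t, x = 2%:R ^+ k * (1 + 2%:R * t).
Proof.
move=> x0; have [n xn] : exists n, x n != 0%N.
  apply/not_existsP => h; move/eqP: x0; apply; apply: dyadic_eq => n.
  by move/negP: (h n); rewrite negbK => /eqP ->; rewrite /= !mod0n.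
elim: n x xn {x0} => [|n IH] x xn; first by rewrite dyadicP modn1 in xn.
have [x1|x1] := eqVneq (x 1%N) 0%N.
  have [y xE] := dyadic_half x1.
  have /IH[k [t yE]] : y n != 0%N.
    apply: contra_neq xn => yn; rewrite xE dyadic_mulE dyadic_natE modnMml.
    apply/eqP; rewrite expnS -/(dvdn _ _) dvdn_pmul2l //.
    by rewrite /dvdn -dyadicP yn.
  by exists k.+1, t; rewrite exprS -mulrA -yE.
have [t xE] : exists t, x - 1 = 2%:R * t.
  apply: dyadic_half.
  have x2 : x 1%N = 1%N.
    have := ltn_mod (x 1%N) (2 ^ 1); rewrite dyadic_small /=.
    by case: (x 1%N) x1 => // -[].
  by rewrite dyadic_addE x2.
by exists 0%N, t; rewrite -xE expr0 mul1r addrC subrK.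
Qed.

(** The partial sums of sum_j e_j 2^j are compatible residues: this is how the
    completeness of the 2-adic integers enters. *)
Lemma dyadic_series_subproof (e : nat -> nat) n :
  \sum_(j < n) 2 ^ j * e j = \sum_(j < n.+1) 2 ^ j * e j %[mod 2 ^ n].
Proof. by rewrite big_ord_recr /= addnC mulnC modnMDl. Qed.

Definition dyadic_series e := dyadic_of (dyadic_series_subproof e).

Lemma dyadic_seriesE e :
  dyadic_series e = (e 0%N)%:R + 2%:R * dyadic_series (fun j => e j.+1).
Proof.
apply: dyadic_eq => n; rewrite dyadic_addE dyadic_mulE !dyadic_natE.
rewrite /= !modnMm !modnDm !modn_mod dyadic_series_subproof big_ord_recl /=.
rewrite expn0 mul1n; congr ((_ + _) %% _)%N; rewrite big_distrr; apply: eq_bigr => j _.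
by rewrite /= mulnA -expnS.
Qed.

Lemma dyadic_two_neq0 : (2%:R : Z2) != 0.
Proof. by apply/eqP => /(congr1 (fun z : Z2 => z 2%N)); rewrite dyadic_natE. Qed.

Lemma fraction_denominator (q : Q2) : exists s n : Z2, s != 0 /\ tofrac s * q = tofrac n.
Proof.
elim/quotW: q => r; exists (frac r).2, (frac r).1; split; first exact: denom_ratioP.
rewrite -[LHS]/(FracField.mul _ _) !piE /FracField.mulf.
rewrite !numden_Ratio ?oner_eq0 // mul1r.
apply/eqmodP; rewrite /= FracField.equivfE.
by rewrite !numden_Ratio ?(oner_eq0, mulf_neq0, denom_ratioP) // mulr1 mulrC.
Qed.

End Dyadic.

(** * The ring of integers of an extension of the 2-adic numbers *)

Section Integers.
Variable K : fieldExtType Q2.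
Local Notation O := (OK K).

Lemma Z2_to_K_inj : injective (Z2_to_K K).
Proof. by move=> a b /fmorph_inj /eqP; rewrite tofrac_eq => /eqP. Qed.

Lemma Z2_to_K_scale (c : Z2) (x : K) : tofrac c *: x = Z2_to_K K c * x.
Proof. by rewrite /Z2_to_K /= mulr_algl. Qed.

Lemma two_neq0 : (2%:R : K) != 0.
Proof.
rewrite -(rmorph_nat (Z2_to_K K)) -(rmorph0 (Z2_to_K K)).
by rewrite (inj_eq Z2_to_K_inj) dyadic_two_neq0.
Qed.

Lemma Z2_OK_subproof (c : Z2) : Z2_to_K K c \in @integral_mem K.
Proof. exact/asboolP/integral_id. Qed.

Definition Z2_OK (c : Z2) : O := exist _ (Z2_to_K K c) (Z2_OK_subproof c).

Lemma Z2_OK_is_zmod_morphism : zmod_morphism Z2_OK.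
Proof. by move=> a b; apply: val_inj; rewrite /= rmorphB. Qed.
Lemma Z2_OK_is_monoid_morphism : monoid_morphism Z2_OK.
Proof. by split=> [|a b]; apply: val_inj; rewrite /= (rmorph1, rmorphM). Qed.
HB.instance Definition _ := GRing.isZmodMorphism.Build Z2 O Z2_OK Z2_OK_is_zmod_morphism.
HB.instance Definition _ := GRing.isMonoidMorphism.Build Z2 O Z2_OK Z2_OK_is_monoid_morphism.

Lemma pow2_inj k (x y : O) : 2%:R ^+ k * x = 2%:R ^+ k * y -> x = y.
Proof.
move=> /(congr1 val); rewrite !rmorphM !rmorphXn !rmorph_nat /= => E; apply: val_inj.
by apply: (mulfI (expf_neq0 k two_neq0)).
Qed.

Lemma common_denominator (I : finType) (q : I -> Q2) :
  exists (s : Z2) (n : I -> Z2), s != 0 /\ forall i, tofrac s * q i = tofrac (n i).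
Proof.
have [s0 sP] := @fin_all_exists _ _ (fun i s => exists n, s != 0 /\ tofrac s * q i = tofrac n)
  (fun i => fraction_denominator (q i)).
have [n0 nP] := fin_all_exists sP.
exists (\prod_i s0 i), (fun i => (\prod_(j | j != i) s0 j) * n0 i); split=> [|i].
  by apply/prodf_neq0 => i _; have [] := nP i.
rewrite (bigD1 i) //= [s0 i * _]mulrC !tofracM -mulrA; congr (_ * _).
by have [] := nP i.
Qed.

(** If x is a root of a monic polynomial of degree N with coefficients p_i, then s x is a
    root of the one with coefficients s^(N-i) p_i, and these are integral as soon as s is
    a common denominator of the p_i. *)
Lemma integral_multiple (x : K) : exists (s : Z2) (w : O), s != 0 /\ val w = Z2_to_K K s * x.
Proof.
pose p := minPoly 1%AS x; pose N := (size p).-1.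
have pmon : p \is monic := monic_minPoly _ _.
have sp : size p = N.+1 by rewrite /N prednK // lt0n size_poly_eq0 monic_neq0.
have [q qE] : exists q : 'I_N -> Q2, forall i : 'I_N, p`_i = q i *: 1.
  apply: (@fin_all_exists _ _ (fun (i : 'I_N) q => p`_i = q *: 1)) => i.
  by apply/vlineP; have /polyOverP := minPolyOver 1%AS x; apply.
have [s [n [s0 nE]]] := common_denominator q.
have lc : p`_N = 1 by move/monicP: pmon; rewrite lead_coefE.
pose r := \poly_(i < N.+1) (Z2_to_K K s ^+ (N - i) * p`_i).
have rN : r`_N = 1 by rewrite coef_poly ltnSn subnn expr0 mul1r lc.
have size_r : size r = N.+1.
  by apply/eqP; rewrite size_poly_eq // subnn expr0 mul1r lc oner_neq0.
have int_r : integralOver (Z2_to_K K) (Z2_to_K K s * x).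
  apply: (@integral_root_monic _ _ _ _ r).
  - by rewrite monicE lead_coefE size_r /= rN.
  - rewrite /root /r horner_poly.
    have := minPolyxx 1%AS x; rewrite -/p horner_coef sp => px.
    apply/eqP; transitivity (Z2_to_K K s ^+ N * \sum_(i < N.+1) p`_i * x ^+ i).
      rewrite mulr_sumr; apply: eq_bigr => i _; rewrite exprMn.
      have -> : Z2_to_K K s ^+ N = Z2_to_K K s ^+ (N - i) * Z2_to_K K s ^+ i.
        by rewrite -exprD subnK // -ltnS.
      by rewrite mulrACA mulrA.
    by rewrite px mulr0.
  - apply/integral_poly => i; rewrite coef_poly; case: ltnP => [iN|_]; last exact: integral0.
    move: iN; rewrite ltnS leq_eqVlt => /orP[/eqP ->|iN].
      by rewrite subnn expr0 mul1r lc; apply: integral1.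
    rewrite -(subnSK iN) exprSr -mulrA; apply: integral_mul.
      by rewrite -rmorphXn; apply: integral_id.
    rewrite (qE (Ordinal iN)) -Z2_to_K_scale scalerA nE Z2_to_K_scale mulr1.
    exact: integral_id.
have wP : Z2_to_K K s * x \in @integral_mem K by apply/asboolP.
by exists s, (exist (fun z : K => is_true (z \in @integral_mem K)) _ wP).
Qed.

(** If x were non-zero, w = s / x would be integral for some s = 2^k (1 + 2t);
    writing x = 2^(k+1) y gives 1 + 2t = 2 y w, so 2 would be a unit of O_K. *)
Lemma OK_separated (x : O) : (forall k, exists y, x = 2%:R ^+ k * y) -> x = 0.
Proof.
move=> h; apply/eqP/negPn/negP => x0.
have vx0 : val x != 0 by apply: contra x0 => /eqP vx; apply/eqP/val_inj.
have [s [w [s0 wE]]] := integral_multiple (val x)^-1.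
have [k [t sE]] := dyadic_neq0_factor s0.
have [y xE] := h k.+1.
have sxw : Z2_OK s = x * w.
  by apply: val_inj; rewrite rmorphM /= wE mulrCA mulfV // mulr1.
have /pow2_inj E : 2%:R ^+ k * (1 + 2%:R * Z2_OK t) = 2%:R ^+ k * (2%:R * (y * w)).
  rewrite -[2%:R * Z2_OK t](_ : Z2_OK (2%:R * t) = _); last by rewrite rmorphM rmorph_nat.
  have -> : 1 + Z2_OK (2%:R * t) = Z2_OK (1 + 2%:R * t) by rewrite rmorphD rmorph1.
  have -> : 2%:R ^+ k * Z2_OK (1 + 2%:R * t) = Z2_OK s.
    by rewrite sE [RHS]rmorphM rmorphXn rmorph_nat.
  by rewrite sxw xE exprSr !mulrA.
have := OK_2nunit (y * w - Z2_OK t).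
by rewrite mulrBr -E addrK eqxx.
Qed.

End Integers.

(** * Bases of the ring of integers over the 2-adic integers *)

Section Basis.
Variable K : fieldExtType Q2.
Local Notation O := (OK K).

Definition mod2_independent m (x : 'I_m -> O) := forall e : 'I_m -> bool,
  (exists z, \sum_i (e i)%:R * x i = 2%:R * z) -> forall i, e i = false.

Definition mod2_spanning m (x : 'I_m -> O) := forall y : O,
  exists (e : 'I_m -> bool) z, y = \sum_i (e i)%:R * x i + 2%:R * z.

(** Reducing a relation modulo 2 shows that its coefficients are even; dividing it by 2
    and repeating shows that they vanish modulo every power of 2. *)
Lemma mod2_independent_Z2 m (x : 'I_m -> O) (c : 'I_m -> Z2) :
  mod2_independent x -> \sum_i Z2_OK K (c i) * x i = 0 -> forall i, c i = 0.
Proof.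
move=> xind c0.
suff H n : forall i, c i n = 0%N.
  by move=> i; apply: dyadic_eq => n; rewrite H /= !mod0n.
elim: n c c0 => [|n IH] c c0 i; first by rewrite dyadicP modn1.
pose e i := c i 1%N == 1%N.
have [y yE] : exists y, forall i, c i = (e i)%:R + 2%:R * y i.
  apply: (@fin_all_exists _ _ (fun i y => c i = (e i)%:R + 2%:R * y)) => {}i.
  have [y yE] : exists y, c i - (e i)%:R = 2%:R * y.
    apply: dyadic_half; rewrite dyadic_addE /e.
    by have := ltn_mod (c i 1%N) (2 ^ 1); rewrite dyadic_small; case: (c i 1%N) => [|[|]].
  by exists y; rewrite -yE addrC subrK.
have cE : \sum_i (e i)%:R * x i + 2%:R * \sum_i Z2_OK K (y i) * x i = 0.
  rewrite -[RHS]c0 mulr_sumr -big_split; apply: eq_bigr => j _.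
  by rewrite /= yE rmorphD rmorphM !rmorph_nat [RHS]mulrDl -[in RHS]mulrA.
have e0 : forall i, e i = false.
  apply: xind; exists (- \sum_i Z2_OK K (y i) * x i).
  by rewrite mulrN; apply/eqP; rewrite -addr_eq0 cE.
have y0 : \sum_i Z2_OK K (y i) * x i = 0.
  apply: (@pow2_inj K 1); rewrite expr1 mulr0.
  by move: cE; rewrite big1 ?add0r // => j _; rewrite e0 mul0r.
have yi := IH _ y0 i.
rewrite yE e0 add0r dyadic_mulE dyadic_natE modnMml.
by apply/eqP; rewrite expnS -/(dvdn _ _) dvdn_pmul2l // /dvdn -dyadicP yi.
Qed.

Lemma mod2_independent_free m (x : 'I_m -> O) :
  mod2_independent x -> free [tuple val (x i) | i < m].
Proof.
move=> xind; apply/freeP => q q0.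
have [s [n [s0 nE]]] := common_denominator q.
have n0 : forall i, n i = 0.
  apply: (mod2_independent_Z2 xind); apply: val_inj; rewrite rmorph_sum /=.
  have := congr1 (fun v => tofrac s *: v) q0; rewrite /= scaler0 scaler_sumr => E; apply: etrans E.
  apply: eq_bigr => i _.
  by rewrite scalerA nE Z2_to_K_scale (nth_map i) ?size_enum_ord // nth_ord_enum.
move=> i; have := nE i; rewrite n0 tofrac0 => /eqP.
by rewrite mulf_eq0 tofrac_eq0 (negPf s0) => /eqP.
Qed.

(** Independent families have at most dim K elements, so there is a maximal one, and
    a maximal independent family spans. *)
Lemma exists_mod2_basis : exists m (x : 'I_m -> O), mod2_independent x /\ mod2_spanning x.
Proof.
pose P m := `[< exists x : 'I_m -> O, mod2_independent x >].
have P0 : exists m, P m.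
  by exists 0%N; apply/asboolP; exists (fun=> 0) => e _ [].
have Pb m : P m -> (m <= \dim {:K})%N.
  move=> /asboolP[x /mod2_independent_free]; rewrite /free size_tuple => /eqP <-.
  exact/dimvS/subvf.
have [m /asboolP[x xind] mmax] := ex_maxnP P0 Pb.
exists m, x; split => // y.
(* adjoin y to the family as entry 0: by maximality there is a relation, and it involves y *)
pose x' (i : 'I_m.+1) := if unlift ord0 i is Some j then x j else y.
have : ~ mod2_independent x'.
  by move=> x'ind; have := mmax m.+1; rewrite ltnn => h; apply/notF/h/asboolP; exists x'.
move=> /existsNP[e] /not_implyP[[z zE]] /existsNP[i0 ei0].
have E : (e ord0)%:R * y + \sum_i (e (lift ord0 i))%:R * x i = 2%:R * z.
  rewrite -zE big_ord_recl /x' unlift_none; congr (_ + _); apply: eq_bigr => i _.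
  by rewrite liftK.
have e0 : e ord0 = true.
  case e0 : (e ord0) => //; exfalso; apply: ei0.
  have h : forall i, e (lift ord0 i) = false.
    by apply: (xind (fun i => e (lift ord0 i))); exists z; rewrite -E e0 mul0r add0r.
  by case: (unliftP ord0 i0) => [j ->|->].
exists (fun i => e (lift ord0 i)), (z - \sum_i (e (lift ord0 i))%:R * x i).
rewrite mulrBr -E e0 mul1r [2%:R * _]mulr_natl mulr2n opprD !addrA.
set S := \sum_i _; by rewrite [S + y]addrC addrK addrK.
Qed.

(** Expand y = sum_i e_i x_i + 2 y', continue with y', and collect the digits e_i into
    2-adic integers. The difference between y and the resulting combination is divisible
    by every power of 2. *)
Lemma mod2_spanning_Z2 m (x : 'I_m -> O) : mod2_spanning x ->
  forall y : O, exists c : 'I_m -> Z2, y = \sum_i Z2_OK K (c i) * x i.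
Proof.
move=> xspan y.
have [e eP] := @choice _ _ (fun y (e : 'I_m -> bool) =>
  exists z, y = \sum_i (e i)%:R * x i + 2%:R * z) xspan.
have [r rE] := choice eP.
pose d i k := (e (iter k r y) i : nat).
(* iter k r y is the k-th remainder, z k its expected expansion *)
pose z k := \sum_i Z2_OK K (dyadic_series (fun j => d i (k + j)%N)) * x i.
have step k : iter k r y - z k = 2%:R * (iter k.+1 r y - z k.+1).
  rewrite {1}(rE (iter k r y)) /z mulrBr /=.
  have -> : \sum_i Z2_OK K (dyadic_series (fun j => d i (k + j)%N)) * x i =
     \sum_i (e (iter k r y) i)%:R * x i + 2%:R * z k.+1.
    rewrite /z mulr_sumr -big_split; apply: eq_bigr => i _ /=.
    rewrite dyadic_seriesE rmorphD rmorphM !rmorph_nat [LHS]mulrDl -[in LHS]mulrA addn0.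
    congr (_ + _ * (Z2_OK K _ * _)); congr dyadic_series.
    by apply: functional_extensionality_dep => j; rewrite addnS.
  by rewrite opprD addrACA subrr add0r.
exists (fun i => dyadic_series (d i)); apply/eqP; rewrite -subr_eq0; apply/eqP.
apply: OK_separated => k; exists (iter k r y - z k).
rewrite -[LHS]/(iter 0 r y - z 0%N).
elim: k => [|k ->]; first by rewrite expr0 mul1r.
by rewrite step exprSr mulrA.
Qed.

End Basis.

(** * Traces and the Frobenius polynomial *)

(** The matrices of f in the two bases are conjugate by the matrices of the identity
    between them. *)
Lemma mxtrace_mxof (F : fieldType) (L : vectType F) (m : nat) (X : m.-tuple L)
    (f : 'End(L)) (A : 'M[F]_m) : basis_of {:L} X ->
  (forall i : 'I_m, f X`_i = \sum_(j < m) A i j *: X`_j) ->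
  \tr (passmx.mxof (vbasis {:L}) (vbasis {:L}) f) = \tr A.
Proof.
move=> bX fX; have mE : m = \dim {:L} by rewrite -(size_basis bX).
subst m; have be := vbasisP {:L}; set e := vbasis _ in be *.
have <- : passmx.mxof X X f = A.
  apply/row_matrixP => i; rewrite !rowE passmx.mul_mxof passmx.vecof_delta fX -rowE.
  apply/rowP => j; rewrite !mxE linear_sum (bigD1 j) //= linearZ /=.
  rewrite coord_free ?(basis_free bX) // eqxx mulr1 big1 ?addr0 // => l lj.
  by rewrite linearZ /= coord_free ?(basis_free bX) // (negPf lj) mulr0.
have -> : passmx.mxof e e f =
    passmx.mxof e X \1%VF *m passmx.mxof X X f *m passmx.mxof X e \1%VF.
  by rewrite -!(passmx.mxof_comp _ _ bX) comp_lfun1l comp_lfun1r.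
rewrite mxtrace_mulC mulmxA -(passmx.mxof_comp _ _ be) comp_lfun1l.
by rewrite passmx.mxof1 ?(basis_free bX) // mul1mx.
Qed.

Section AdditivePolynomials.
Variables (k : fieldType) (m : nat) (b : 'I_m -> k).
Hypothesis char2 : 2%N \in [pchar k].
Hypothesis b_indep : forall e : 'I_m -> bool,
  \sum_i (e i)%:R * b i = 0 -> forall i, e i = false.

Lemma exprD_pow2 j (x y : k) : (x + y) ^+ (2 ^ j) = x ^+ (2 ^ j) + y ^+ (2 ^ j).
Proof. by apply: exprDn_pchar; rewrite pnatX pnatE // char2. Qed.

Lemma expr_sum_pow2 j (I : finType) (F : I -> k) :
  (\sum_i F i) ^+ (2 ^ j) = \sum_i F i ^+ (2 ^ j).
Proof.
elim/big_rec2: _ => [|i x y _ <-]; last exact: exprD_pow2.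
by rewrite expr0n expn_eq0.
Qed.

(** The additive polynomial sum_j u_j X^(2^j) vanishes on the span of the b_i, which has
    2^m elements, while its degree is at most 2^(m-1). *)
Lemma additive_poly_eq0 (u : 'I_m -> k) :
  (forall i, \sum_(j < m) u j * b i ^+ (2 ^ j) = 0) -> forall j, u j = 0.
Proof.
move=> ub j0; pose P : {poly k} := \sum_(j < m) u j *: 'X^(2 ^ j).
suff P0 : P = 0.
  have := congr1 (fun p : {poly k} => p`_(2 ^ j0)) P0.
  rewrite coef0 coef_sum (bigD1 j0) //= coefZ coefXn eqxx mulr1 big1 ?addr0 // => j jj0.
  by rewrite coefZ coefXn eqn_exp2l // eq_sym (inj_eq val_inj) (negPf jj0) mulr0.
have two0 : 2%:R = 0 :> k by apply: pcharf0.
have addkk (y : k) : y + y = 0 by rewrite -mulr2n -mulr_natr two0 mulr0.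
pose ev (e : {ffun 'I_m -> bool}) := \sum_i (e i)%:R * b i.
have ev_inj : injective ev.
  move=> e e' E; apply/ffunP => i; apply/eqP; rewrite -negb_add; apply/negbT.
  apply: (b_indep (e := fun i => e i (+) e' i)).
  rewrite -[RHS](addkk (ev e')) -{1}E -big_split; apply: eq_bigr => l _ /=.
  rewrite -mulrDl; congr (_ * _); case: (e l) (e' l) => -[] /=; rewrite ?addr0 ?add0r ?addkk //.
apply/eqP/negPn/negP => P0.
have := max_poly_roots P0 (rs := codom ev).
rewrite map_inj_uniq ?enum_uniq // size_codom card_ffun card_bool card_ord.
have Proots : all (root P) (codom ev).
  apply/allP => _ /codomP[e ->]; apply/eqP; rewrite horner_sum.
  under eq_bigr => j _ do rewrite hornerZ hornerXn expr_sum_pow2 mulr_sumr.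
  rewrite exchange_big big1 // => i _.
  transitivity ((e i)%:R * \sum_(j < m) u j * b i ^+ (2 ^ j)); last by rewrite ub mulr0.
  rewrite mulr_sumr; apply: eq_bigr => j _; rewrite exprMn.
  by case: (e i) => /=; rewrite ?expr1n ?mul1r // expr0n expn_eq0 /= !mul0r mulr0.
move=> /(_ Proots isT).
have : (size P <= (2 ^ m.-1).+1)%N.
  apply: (leq_trans (size_sum _ _ _)); apply/bigmax_leqP => j _.
  apply: (leq_trans (size_scale_leq _ _)); rewrite size_polyXn ltnS leq_exp2l //.
  by rewrite -ltnS prednK // (leq_ltn_trans _ (ltn_ord j)).
have m0 : (0 < m)%N by apply: leq_ltn_trans (ltn_ord j0).
move=> h /leq_trans -/(_ _ h); rewrite ltnS leq_exp2l //.
by case: (m) m0 => // m' _; rewrite ltnn.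
Qed.

(** Raising x b_i = sum_l M_il b_l to the power 2^j shows that M is conjugate to the diagonal
    matrix of the x^(2^j) by the Moore matrix (b_i^(2^j)), which is invertible
    by [additive_poly_eq0]. *)
Lemma trace_frobenius (x : k) (M : 'M[k]_m) :
  (forall i j, M i j ^+ 2 = M i j) -> (forall i, x * b i = \sum_j M i j * b j) ->
  \tr M = \sum_(j < m) x ^+ (2 ^ j).
Proof.
move=> Midem Mx.
(* B is the Moore matrix of the family b *)
pose B := \matrix_(i < m, j < m) b i ^+ (2 ^ j).
pose d := \row_(j < m) x ^+ (2 ^ j).
have Mpow i l j : M i l ^+ (2 ^ j) = M i l.
  by elim: j => [|j IH]; rewrite ?expr1 // expnSr exprM IH.
have MB : M *m B = B *m diag_mx d.
  apply/matrixP => i j; rewrite mul_mx_diag !mxE mulrC -exprMn Mx expr_sum_pow2.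
  by apply: eq_bigr => l _; rewrite !mxE exprMn Mpow.
have Bunit : B \in unitmx.
  rewrite -unitmx_tr unitmxE unitfE; apply/det0P => -[v v0 vB].
  case/eqP: v0; apply/rowP => j; rewrite [RHS]mxE; move: j.
  apply: additive_poly_eq0 => i; have := congr1 (fun w : 'rV_m => w 0 i) vB.
  by rewrite !mxE => h; rewrite -[RHS]h; apply: eq_bigr => j _; rewrite !mxE.
rewrite -[M](mulmxK Bunit) MB mxtrace_mulC mulmxA mulVmx // mul1mx mxtrace_diag.
by apply: eq_bigr => j _; rewrite mxE.
Qed.

Lemma exists_frobenius_sum_neq0 : (0 < m)%N -> exists x : k, \sum_(j < m) x ^+ (2 ^ j) != 0.
Proof.
move=> m0; apply/not_existsP => h.
have z i : \sum_(j < m) 1 * b i ^+ (2 ^ j) = 0.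
  have := h (b i); move=> /negP; rewrite negbK => /eqP E; apply: etrans E.
  by apply: eq_bigr => j _; rewrite mul1r.
by have /eqP := additive_poly_eq0 z (Ordinal m0); rewrite oner_eq0.
Qed.

End AdditivePolynomials.

(** * The trace of an unramified extension modulo 2 and 4 *)

Section Trace.
Variable K : fieldExtType Q2.
Local Notation O := (OK K).

(** An element outside 2 O_K is invertible since K is unramified, and hence so is its
    residue. *)
Lemma residue_field : unramified K ->
  exists (k : fieldType) (f : {rmorphism O -> k}),
    (forall y, exists x, f x = y) /\ (forall x, f x = 0 <-> exists y, x = 2%:R * y).
Proof.
move=> Kur; pose rr := residue_ring K.
pose inv (x : rr) : rr := if pselect (exists y, y * x = 1) is left h then projT1 (cid h) else 0.
have to0 (a : O) : to_residue a = 0 <-> exists y, a = 2%:R * y.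
  have -> : (0 : rr) = to_residue (0 : O) by rewrite /to_residue raddf0.
  rewrite /to_residue; split=> [/eqP|h].
    by rewrite -Quotient.idealrBE subr0 => /asboolP.
  by apply/eqP; rewrite -Quotient.idealrBE subr0; apply/asboolP.
have invP (x : rr) : x != 0 -> inv x * x = 1.
  have [a ->] := residueP x => a0; rewrite /inv; case: pselect => [h|]; first exact: (projT2 (cid h)).
  case; apply: contrapT => h; move/eqP: a0; apply; apply/to0/Kur => -[y ya].
  by apply: h; exists (to_residue y); rewrite /to_residue -rmorphM ya rmorph1.
have inv0 : inv 0 = 0.
  rewrite /inv; case: pselect => // h; exfalso; case: h => y.
  by rewrite mulr0 => /esym/eqP; rewrite oner_eq0.
pose k : fieldType := HB.pack rr (GRing.ComNzRing_isField.Build rr invP inv0).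
pose f : O -> k := @to_residue K.
have fB : zmod_morphism f by move=> x y; rewrite /f /to_residue raddfB.
have fM : monoid_morphism f by split=> [|x y]; rewrite /f /to_residue (rmorph1, rmorphM).
pose F : {rmorphism O -> k} := HB.pack f (GRing.isZmodMorphism.Build _ _ f fB)
  (GRing.isMonoidMorphism.Build _ _ f fM).
exists k, F; split => [y|//]; have [a ->] := residueP y; by exists a.
Qed.

(** A basis modulo 2 is a basis of O_K over Z_2 and of K over Q_2, so the trace over Q_2 of
    an integral element is that of a matrix with entries in Z_2. *)
Lemma OK_traceP m (x : 'I_m -> O) : mod2_independent x -> mod2_spanning x ->
  forall y, exists M : 'M[Z2]_m,
    (forall i, y * x i = \sum_j Z2_OK K (M i j) * x j) /\
    tofrac (\tr M) = field_trace (val y).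
Proof.
move=> xind xspan y.
have [M0 M0E] := @choice _ _ (fun i (c : 'I_m -> Z2) => y * x i = \sum_j Z2_OK K (c j) * x j)
  (fun i => mod2_spanning_Z2 xspan (y * x i)).
pose M := \matrix_(i, j) M0 i j; exists M; split=> [i|].
  by rewrite M0E; apply: eq_bigr => j _; rewrite mxE.
pose X := [tuple val (x i) | i < m].
have XE (i : 'I_m) : X`_i = val (x i).
  by rewrite (nth_map i) ?size_enum_ord // nth_ord_enum.
have bX : basis_of {:K} X.
  rewrite basisEfree mod2_independent_free // subvf /=.
  apply: (@leq_trans (\dim <<X>>)); last by rewrite (leq_trans (dim_span _)).
  apply/dimvS/subvP => v _.
  (* a multiple s v is integral, hence a combination of the x_i over Z_2 *)
  have [s [w [s0 wE]]] := integral_multiple v.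
  have [c cE] := mod2_spanning_Z2 xspan w.
  have -> : v = \sum_i ((tofrac s)^-1 * tofrac (c i)) *: X`_i.
    apply: (scalerI (a := tofrac s)); first by rewrite tofrac_eq0.
    rewrite Z2_to_K_scale -wE cE rmorph_sum scaler_sumr; apply: eq_bigr => i _.
    by rewrite scalerA mulVKf ?tofrac_eq0 // Z2_to_K_scale XE rmorphM.
  by apply: memv_suml => i _; apply/memvZ/memv_span/mem_nth; rewrite size_tuple.
have := @mxtrace_mxof _ _ _ X (amull (val y)) (map_mx (@tofrac Z2) M) bX.
rewrite /field_trace => ->; last first.
  move=> i; rewrite lfunE /= XE; transitivity (val (y * x i)); first by [].
  rewrite M0E rmorph_sum; apply: eq_bigr => j _.
  by rewrite !mxE Z2_to_K_scale XE rmorphM.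
by rewrite /mxtrace rmorph_sum; apply: eq_bigr => i _; rewrite !mxE.
Qed.

Lemma OK_traceE (y : O) : tofrac (OK_trace y) = field_trace (val y).
Proof.
have [m [x [xind xspan]]] := exists_mod2_basis K.
have [M [_ ME]] := OK_traceP xind xspan y.
by apply: (@xgetPex _ 0 [set z : Z2 | tofrac z = field_trace (val y)]); exists (\tr M).
Qed.

Lemma OK_traceD (y z : O) : OK_trace (y + z) = OK_trace y + OK_trace z.
Proof.
apply/eqP; rewrite -tofrac_eq tofracD !OK_traceE rmorphD /field_trace.
have -> : amull (val y + val z) = amull (val y) + amull (val z).
  by apply/lfunP => w; rewrite add_lfunE !lfunE /= mulrDl.
by rewrite -[amull (val y)]scale1r passmx.mxof_linear !scale1r mxtraceD.
Qed.

(** The residue of the trace of y is the trace of the residue of y, by the same matrix in a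
    basis over Z_2; the latter is a Frobenius sum, and not all of these vanish. *)
Lemma exists_odd_trace : unramified K -> exists y : O, forall z, OK_trace y <> 2%:R * z.
Proof.
move=> Kur.
have [m [x [xind xspan]]] := exists_mod2_basis K.
have [k [f [fsurj f0]]] := residue_field Kur.
have f2 : f 2%:R = 0 by apply/f0; exists 1; rewrite mulr1.
have char2 : 2%N \in [pchar k].
  by rewrite inE /= -(rmorph_nat f) f2 eqxx.
have fx_indep (e : 'I_m -> bool) : \sum_i (e i)%:R * f (x i) = 0 -> forall i, e i = false.
  move=> e0; apply: xind; apply/f0; rewrite -[RHS]e0 rmorph_sum; apply: eq_bigr => i _.
  by rewrite rmorphM rmorph_nat.
have m0 : (0 < m)%N.
  case: m x xind xspan {fx_indep} => // x _ /(_ 1)[e [z]]; rewrite big_ord0 add0r => E.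
  by have := OK_2nunit z; rewrite -E eqxx.
have [xi xi0] := exists_frobenius_sum_neq0 char2 fx_indep m0.
have [y yE] := fsurj xi; exists y => z.
have [M [Mx MT]] := OK_traceP xind xspan y.
have -> : OK_trace y = \tr M by apply/eqP; rewrite -tofrac_eq OK_traceE MT.
move=> trM; case/negP: xi0; pose g c := f (Z2_OK K c).
have g_idem c : g c ^+ 2 = g c.
  rewrite /g; have [c0|c1] := eqVneq (c 1%N) 0%N.
    have [t ->] := dyadic_half c0.
    by rewrite !rmorphM !rmorph_nat -(rmorph_nat f) f2 mul0r expr0n.
  have [t tE] : exists t, c - 1 = 2%:R * t.
    apply: dyadic_half; rewrite dyadic_addE.
    by have := ltn_mod (c 1%N) (2 ^ 1); rewrite dyadic_small; case: (c 1%N) c1 => [|[|]].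
  have -> : c = 1 + 2%:R * t by rewrite -tE addrC subrK.
  by rewrite !rmorphD !rmorphM !rmorph_nat -(rmorph_nat f 2) f2 mul0r addr0 !rmorph1 expr1n.
rewrite -(@trace_frobenius k m (fun i => f (x i)) char2 fx_indep xi (map_mx g M)).
- have -> : \tr (map_mx g M) = g (\tr M).
    by rewrite /mxtrace /g !rmorph_sum; apply: eq_bigr => i _; rewrite mxE.
  by rewrite trM /g !rmorphM !rmorph_nat -(rmorph_nat f) f2 mul0r.
- by move=> i j; rewrite mxE.
- move=> i; rewrite -yE -rmorphM Mx rmorph_sum; apply: eq_bigr => j _.
  by rewrite mxE rmorphM.
Qed.

(** The trace form is perfect modulo 2: otherwise r is a unit and r O_K = O_K contains
    an element of odd trace. *)
Lemma even_trace_even (r : O) : unramified K ->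
  (forall x, exists z, OK_trace (r * x) = 2%:R * z) -> exists y, r = 2%:R * y.
Proof.
move=> Kur h; apply/(Kur r) => -[u ur].
have [y yodd] := exists_odd_trace Kur.
have [z] := h (u * y); rewrite mulrA [r * u]mulrC ur mul1r; exact: yodd.
Qed.

Lemma to_RK_eq (a b : O) : to_RK a = to_RK b <-> exists y, a - b = 2%:R ^+ 2 * y.
Proof.
rewrite /to_RK; split=> [/eqP|h]; first by rewrite -Quotient.idealrBE => /asboolP.
by apply/eqP; rewrite -Quotient.idealrBE; apply/asboolP.
Qed.

Lemma RKP (z : RK K) : exists a, z = to_RK a.
Proof. by exists (repr z); rewrite /to_RK reprK. Qed.

Lemma OK_traceM4 (y : O) : OK_trace (2%:R ^+ 2 * y) = 2%:R ^+ 2 * OK_trace y.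
Proof.
have D2 (w : O) : OK_trace (2%:R * w) = 2%:R * OK_trace w.
  by rewrite [2%:R * w]mulr_natl mulr2n OK_traceD [RHS]mulr_natl mulr2n.
by rewrite !expr2 -!mulrA !D2.
Qed.

Lemma trR_to_RK (a : O) : (trR (to_RK a) : nat) = OK_trace a 2%N.
Proof.
have [y yE] : exists y, repr (to_RK a) - a = 2%:R ^+ 2 * y.
  by apply/to_RK_eq; rewrite /to_RK reprK.
rewrite /trR -[repr _](subrK a) yE OK_traceD OK_traceM4.
rewrite dyadic_addE dyadic_mulE /= -[X in _ = X]dyadic_small.
by rewrite /Zp_trunc /=; do ?rewrite ?modn_mod ?mulnAC.
Qed.

Lemma trRD (x y : RK K) : (trR (x + y) : nat) = ((trR x + trR y) %% 4)%N.
Proof.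
have [a ->] := RKP x; have [b ->] := RKP y.
have -> : to_RK a + to_RK b = to_RK (a + b) by rewrite /to_RK rmorphD.
by rewrite !trR_to_RK OK_traceD dyadic_addE.
Qed.

Lemma trR0 : (trR (0 : RK K) : nat) = 0%N.
Proof.
have := trRD 0 0; rewrite addr0; have : (trR (0%R : RK K) < 4)%N by apply: ltn_ord.
move: (nat_of_ord (trR (0 : RK K))) => t.
by case: t => [|[|[|[|t]]]].
Qed.

(** This is [even_trace_even] modulo 4: that 2 r x has trace 0 modulo 4 means that r x has
    even trace. *)
Lemma RK_even (r : RK K) : unramified K ->
  (forall x, (trR (2%:R * (r * x)) : nat) = 0%N) -> exists s, r = 2%:R * s.
Proof.
move=> Kur h; have [a rE] := RKP r; subst r.
have [b ->] : exists b, a = 2%:R * b.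
  apply: even_trace_even => // x.
  have := h (to_RK x); have -> : 2%:R * (to_RK a * to_RK x) = to_RK (a * x + a * x).
    by rewrite mulr_natl mulr2n /to_RK -rmorphM -rmorphD.
  rewrite trR_to_RK OK_traceD; move: (OK_trace (a * x)) => c c2.
  apply: dyadic_half; move: c2; rewrite dyadic_addE -(@dyadic_le c 1 2) //.
  have := ltn_mod (c 2%N) (2 ^ 2); rewrite dyadic_small.
  by case: (c 2%N) => [|[|[|[|]]]].
by exists (to_RK b); rewrite /to_RK rmorphM rmorph_nat.
Qed.

Lemma RK_2torsion (c : RK K) : 2%:R * c = 0 -> exists s, c = 2%:R * s.
Proof.
have [a ->] := RKP c.
have -> : 2%:R * to_RK a = to_RK (2%:R * a) by rewrite /to_RK rmorphM rmorph_nat.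
have -> : (0 : RK K) = to_RK 0 by rewrite /to_RK rmorph0.
move=> /to_RK_eq[y]; rewrite subr0 expr2 -mulrA -[X in X * a]expr1 -[X in X * (2%:R * y)]expr1.
by move=> /pow2_inj ->; exists (to_RK y); rewrite /to_RK rmorphM rmorph_nat.
Qed.

End Trace.

(** * The character psi and the form omega *)

Section Psi.
Variables (RR : realType) (K : fieldExtType Q2).
Local Notation C := RR[i].
Local Notation ps := (psi RR).

Lemma psiE (z : RK K) : ps z = 'i ^+ (trR z).
Proof.
rewrite /psi; move: (nat_of_ord (trR z)) => k {z}.
have -> : 2%:R * pi / 4%:R * k%:R = (pi / 2%:R) *+ k :> RR.
  by rewrite -mulr_natr; field.
elim: k => [|k IH]; first by rewrite mulr0n cos0 sin0 expr0.
rewrite mulrS cosD sinD cos_pihalf sin_pihalf exprS -IH -complexiE.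
by rewrite !mul0r !mul1r sub0r addr0; congr Complex; rewrite !mul0r !mul1r ?sub0r ?add0r ?addr0.
Qed.

Lemma imaginaryX4 : ('i : C) ^+ 4 = 1.
Proof. by rewrite -[4%N]/(2 * 2)%N exprM sqrCi sqrrN expr1n. Qed.

Lemma psiD (x y : RK K) : ps (x + y) = ps x * ps y.
Proof.
rewrite !psiE trRD -exprD [in RHS](divn_eq (trR x + trR y) 4) exprD mulnC exprM.
by rewrite imaginaryX4 expr1n mul1r.
Qed.

Lemma psi0 : ps (0 : RK K) = 1.
Proof. by rewrite psiE trR0 expr0. Qed.

Lemma psiX4 (x : RK K) : ps x ^+ 4 = 1.
Proof. by rewrite psiE exprAC imaginaryX4 expr1n. Qed.

Lemma psi_eq1 (x : RK K) : ps x = 1 -> (trR x : nat) = 0%N.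
Proof.
rewrite psiE; have : (trR x < 4)%N by apply: ltn_ord.
move: (nat_of_ord (trR x)) => t; case: t => [|[|[|[|t]]]] // _.
- rewrite expr1 => /(congr1 (fun z => z ^+ 2)); rewrite sqrCi expr1n => /eqP.
  by rewrite eq_sym -subr_eq0 opprK (pnatr_eq0 _ 2).
- by rewrite sqrCi => /eqP; rewrite eq_sym -subr_eq0 opprK (pnatr_eq0 _ 2).
- rewrite exprS sqrCi mulrN1 => /(congr1 (fun z => z ^+ 2)); rewrite sqrrN sqrCi expr1n => /eqP.
  by rewrite eq_sym -subr_eq0 opprK (pnatr_eq0 _ 2).
Qed.

(** For x with 2x = 0 the value psi x is a sign; this is its exponent. *)
Definition psi_sign (x : RK K) : bool := ps x != 1.

Lemma psi_signE (x : RK K) : 2%:R * x = 0 -> ps x = (-1) ^+ psi_sign x.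
Proof.
move=> x2; have : ps x ^+ 2 = 1 by rewrite expr2 -psiD -psi0 -x2 mulr_natl mulr2n.
rewrite /psi_sign; case: eqP => // n1 /eqP; rewrite sqrf_eq1 => /orP[/eqP //|/eqP ->].
by rewrite expr1.
Qed.

Lemma psi_signD (x y : RK K) : 2%:R * x = 0 -> 2%:R * y = 0 ->
  psi_sign (x + y) = psi_sign x (+) psi_sign y.
Proof.
move=> x2 y2; apply: (@signr_inj C).
by rewrite signr_addb -!psi_signE // ?mulrDr ?x2 ?y2 ?addr0 // psiD.
Qed.

End Psi.

Section Symplectic.
Variables (RR : realType) (K : fieldExtType Q2) (n : nat) (D : split_symplectic K n).
Local Notation Vt := (ss_mod D).
Local Notation V := (mod2 Vt).
Local Notation R := (RK K).

Lemma mod2_exponent (x : V) : x + x = 0.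
Proof.
have [u ->] := mod2P x; rewrite -(to_mod2D u u).
have -> : (0 : V) = to_mod2 (0 : Vt) by rewrite /to_mod2 raddf0.
by apply/to_mod2_eq; exists u; rewrite subr0 scaler_nat mulr2n.
Qed.

Lemma beta_2torsion (x y : V) : 2%:R * beta (D := D) x y = 0.
Proof. by rewrite /beta mulrA RK_4eq0 mul0r. Qed.

(** Both summands of the splitting are Lagrangian and the form is alternating, so only
    the mixed terms remain. After doubling this is the relation between beta and
    omega. *)
Lemma ss_form_split (u v : Vt) :
  ss_form u v = beta_lift u v - beta_lift v u.
Proof.
have [[hr hl] alt _] := ss_symplectic D.
have addl (a b c : Vt) : ss_form (a + b) c = ss_form a c + ss_form b c.
  by rewrite -[a in LHS]scale1r hl mul1r.
have addr (a b c : Vt) : ss_form a (b + c) = ss_form a b + ss_form a c.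
  by rewrite -[b in LHS]scale1r hr mul1r.
have [ul um uE] := ss_projP u; have [vl vm vE] := ss_projP v.
have anti (a b : Vt) : ss_form a b = - ss_form b a.
  by apply/eqP; rewrite -addr_eq0; have := alt (a + b); rewrite addl !addr !alt add0r addr0 => ->.
rewrite {1}uE {1}vE addl !addr /beta_lift.
have [_ /(_ (ss_projL v))[/(_ vl) LL _]] := ss_L_lagrangian D.
have [_ /(_ (ss_projM v))[/(_ vm) MM _]] := ss_M_lagrangian D.
by rewrite (LL _ ul) (MM _ um) addr0 add0r; congr (_ + _); apply: anti.
Qed.

(** The form pairs 2u to 0 with everything, so 2u = 0 because the form is symplectic; the
    coordinates of u in a basis are then killed by 2 and hence divisible by 2. *)
Lemma ss_form_even (u : Vt) : (forall v, exists s, ss_form u v = 2%:R * s) ->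
  exists w, u = 2%:R *: w.
Proof.
move=> h; have [[hr hl] alt nd] := ss_symplectic D.
have u0 : 2%:R *: u = 0.
  have f0 : scalar (fun _ : Vt => 0 : R) by move=> a x y; rewrite mulr0 addr0.
  pose f : {scalar Vt} := HB.pack (fun _ : Vt => 0 : R) (GRing.isLinear.Build _ _ _ _ _ f0).
  have [w [_ wu]] := nd f.
  have zl (v : Vt) : ss_form 0 v = 0.
    by have := hl v 1 0 0; rewrite scale1r mul1r addr0 => E; apply: (addrI (ss_form 0 v)); rewrite -E addr0.
  have w0 : w = 0 by apply: wu => v; rewrite zl.
  rewrite -[RHS]w0; apply/esym/wu => v /=; have [s sE] := h v.
  have := hl v 2%:R u 0; rewrite zl !addr0 => ->.
  by rewrite sE mulrA RK_4eq0 mul0r.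
have [b [_ bb]] := ss_free D.
have [c [cE _]] := bb u isT.
have [c0 [_ c0u]] := bb 0 isT.
have two0 i : 2%:R * c 0 i = 0.
  have E1 : c0 = 0 by apply: c0u; rewrite big1 // => j _; rewrite mxE scale0r.
  have E2 : c0 = 2%:R *: c.
    apply: c0u; apply: etrans (esym u0) _; rewrite {1}cE scaler_sumr.
    by apply: eq_bigr => j _; rewrite mxE scalerA.
  by have := congr1 (fun r : 'rV_(2 * n) => r 0 i) E2; rewrite E1 !mxE => <-.
have [s sE] := @choice _ _ (fun i t => c 0 i = 2%:R * t) (fun i => RK_2torsion (two0 i)).
exists (\sum_i s i *: b i); rewrite cE scaler_sumr; apply: eq_bigr => i _.
by rewrite scalerA sE.
Qed.

Definition beta_sign (x y : V) : bool := psi_sign RR (beta x y).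

Lemma beta_signDl (x x' y : V) : beta_sign (x + x') y = beta_sign x y (+) beta_sign x' y.
Proof. by rewrite /beta_sign betaDl psi_signD ?beta_2torsion. Qed.
Lemma beta_signDr (x y y' : V) : beta_sign x (y + y') = beta_sign x y (+) beta_sign x y'.
Proof. by rewrite /beta_sign betaDr psi_signD ?beta_2torsion. Qed.

(** If the commutator form vanishes on (t, -) and u lifts t, then psi(2 r ss_form u v) = 1
    for all r in R and all v, because v can be replaced by r v. Perfectness of the
    trace form makes ss_form u v divisible by 2 for all v, and then u is. *)
Lemma beta_sign_nondeg (t : V) : unramified K ->
  (forall v, beta_sign v t = beta_sign t v) -> t = 0.
Proof.
move=> Kur; have [u ->] := mod2P t => h.
have [w ->] : exists w, u = 2%:R *: w.
  apply: ss_form_even => v; apply: RK_even => // r; apply: (@psi_eq1 RR).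
  have [[hr hl] _ _] := ss_symplectic D.
  have zr : ss_form u 0 = 0.
    have := hr u 1 0 0; rewrite scale1r mul1r addr0 => E.
    by apply: (addrI (ss_form u 0)); rewrite -E addr0.
  have -> : ss_form u v * r = ss_form u (r *: v).
    by have := hr u r v 0; rewrite !addr0 zr addr0 mulrC.
  rewrite ss_form_split mulrBr -!betaE.
  have -> : - beta (to_mod2 (r *: v)) (to_mod2 u) = beta (to_mod2 (r *: v)) (to_mod2 u) :> R.
    by apply/esym/eqP; rewrite -addr_eq0 -mulr2n -mulr_natl beta_2torsion.
  rewrite psiD !psi_signE ?beta_2torsion // -!/(beta_sign _ _) h -signr_addb.
  by rewrite addbb.
have -> : (0 : V) = to_mod2 (0 : Vt) by rewrite /to_mod2 raddf0.
by apply/to_mod2_eq; exists w; rewrite subr0.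
Qed.

(** Combinations with coefficients in a set of representatives modulo 2, taken from a basis
    of O_K, represent all coordinates of V. *)
Lemma mod2_enum : exists s : seq V, forall v, v \in s.
Proof.
have [m [x [xind xspan]]] := exists_mod2_basis K.
have [b [_ bb]] := ss_free D.
pose E (e : {ffun 'I_(2 * n) * 'I_m -> bool}) : V :=
  to_mod2 (\sum_j (\sum_i (e (j, i))%:R * to_RK (x i)) *: b j).
exists (codom E) => v; have [u ->] := mod2P v.
have [c [cE _]] := bb u isT.
have [e eP] : exists e : 'I_(2 * n) -> 'I_m -> bool, forall j, exists s,
    c 0 j = \sum_i (e j i)%:R * to_RK (x i) + 2%:R * s.
  have [//|e eP] := @choice _ _ (fun j (e : 'I_m -> bool) => exists s,
      c 0 j = \sum_i (e i)%:R * to_RK (x i) + 2%:R * s).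
    move=> j; have [a ->] := RKP (c 0 j); have [e [z ->]] := xspan a; exists e, (to_RK z).
    rewrite /to_RK rmorphD rmorph_sum rmorphM rmorph_nat; congr (_ + _).
    by apply: eq_bigr => i _; rewrite rmorphM rmorph_nat.
  by exists e.
have [s sE] := choice eP.
suff -> : to_mod2 u = E [ffun ji => e ji.1 ji.2] by apply: codom_f.
apply/to_mod2_eq; exists (\sum_j s j *: b j).
rewrite cE -sumrB scaler_sumr; apply: eq_bigr => j _.
rewrite -scalerBl scalerA; congr (_ *: _).
rewrite sE; under [X in _ - X]eq_bigr => i _ do rewrite ffunE /=.
by rewrite addrC addKr.
Qed.

End Symplectic.

(** * Central extensions from groups of lifts *)

Section FiniteZmodule.
Variables (V : zmodType) (s : seq V) (sP : forall v, v \in s).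

Definition onth_enum k := if (k < size s)%N then Some (nth 0 s k) else None.

Lemma index_onthK : pcancel (index^~ s) onth_enum.
Proof. by move=> v; rewrite /onth_enum index_mem sP nth_index. Qed.

Lemma undup_enumP : Finite.axiom (undup s).
Proof. by apply: Finite.uniq_enumP => [|v]; rewrite ?undup_uniq // mem_undup sP. Qed.

(** The zmodType V itself, equipped with the finite structure given by the enumeration s;
    its carrier is convertible to V. *)
Definition finite_zmodule : finZmodType :=
  let isc := PCanIsCountable index_onthK in
  let Vc : countType := HB.pack (GRing.Zmodule.sort V) isc in
  HB.pack_for finZmodType (GRing.Zmodule.sort V) isc (isFinite.Build Vc undup_enumP).
End FiniteZmodule.

Section ScalarGL.
Variables (F : fieldType) (H : lmodType F).

Lemma scalar_gl_linear (z : F) : linear (fun v : H => z *: v).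
Proof. by move=> a u v; rewrite scalerDr !scalerA mulrC. Qed.

Lemma scalar_gl_bij (z : F) : z != 0 -> bijective (fun v : H => z *: v).
Proof.
by move=> z0; exists (fun v => z^-1 *: v) => v; rewrite scalerA ?mulVf ?mulfV // scale1r.
Qed.

Definition scalar_gl (z : mu4 F) : GL H :=
  MkGL (@scalar_gl_linear (val z)) (scalar_gl_bij (mu4_neq0 z)).
End ScalarGL.

Section Subgroup.
Variables (G : groupType) (P : {pred G}) (Pcl : group_closed P).
(** The proof of closure is an argument of the type so that the group structure below can be
    attached to it. *)
Definition subgroup_type of group_closed P := {x : G | x \in P}.
Local Notation S := (subgroup_type Pcl).
HB.instance Definition _ := SubChoice.on S.
HB.instance Definition _ := SubChoice_isSubGroup.Build G P S Pcl.
End Subgroup.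

(** The extension is the group P of lifts itself, with its two projections; scalar operators
    are central because they commute with all linear maps. *)
Lemma central_extension_of_lifts (F : fieldType) (H : lmodType F) (G : groupType)
    (P : {pred G * GL H}) (v0 : H) :
  v0 != 0 -> group_closed P -> (forall g, exists A, (g, A) \in P) ->
  (forall A, (1%g, A) \in P <-> exists z : mu4 F, A = scalar_gl H z) ->
  exists (E : groupType) (i : {multiplicative mu4 F -> E})
         (p : {multiplicative E -> G}) (rho : {multiplicative E -> GL H}),
    central_extension i p /\ forall x, (p x, rho x) \in P.
Proof.
move=> v00 Pcl Psurj Pker; pose E : groupType := subgroup_type Pcl.
have iP z : (1%g, scalar_gl H z) \in P by apply/Pker; exists z.
pose i z : E := exist (fun x => x \in P) _ (iP z).
have iM : {morph i : x y / (x * y)%g}.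
  move=> x y; apply: val_inj; congr (_, _); first by rewrite /= mulg1.
  by apply: gl_eq => v /=; rewrite scalerA.
pose p (x : E) : G := (val x).1.
have pM : {morph p : x y / (x * y)%g} by [].
pose rho (x : E) : GL H := (val x).2.
have rhoM : {morph rho : x y / (x * y)%g} by [].
pose im : {multiplicative mu4 F -> E} := HB.pack i (isMultiplicative.Build _ _ i iM).
pose pm : {multiplicative E -> G} := HB.pack p (isMultiplicative.Build _ _ p pM).
pose rhom : {multiplicative E -> GL H} := HB.pack rho (isMultiplicative.Build _ _ rho rhoM).
exists E, im, pm, rhom.
split; last by move=> x; rewrite /= /p /rho -surjective_pairing; apply: valP.
split=> [x y|g|x|a x].
- move=> /(congr1 (fun e : E => rho e v0)) /= /eqP.
  by rewrite -subr_eq0 -scalerBl scaler_eq0 (negPf v00) orbF subr_eq0 => /eqP xy; apply: val_inj.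
- by have [A gA] := Psurj g; exists (exist (fun x => x \in P) _ gA).
- split=> [px|[z ->]] //.
  have xP : (1%g, rho x) \in P.
    by have := valP x; rewrite [val x]surjective_pairing -/(p x) -/(rho x) => h; rewrite -px.
  have [z zE] := (Pker _).1 xP; exists z; apply: val_inj.
  by rewrite [LHS]surjective_pairing /=; congr (_, _).
- apply: val_inj; rewrite /=; congr (_, _); first by rewrite mulg1 mul1g.
  by apply: gl_eq => v /=; rewrite linearZ.
Qed.

(** * The affine metaplectic group *)

Section Representation.
Variables (RR : realType) (K : fieldExtType Q2) (n : nat).
Variables (D : split_symplectic K n) (H : lmodType RR[i]).
Variables (r : {multiplicative Heis D -> GL H}) (rH : heisenberg_representation r).
Local Notation V := (mod2 (ss_mod D)).
Variables (s : seq V) (sP : forall v, v \in s).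
Local Notation Vf := (finite_zmodule sP).

Definition weyl (v : Vf) : {linear H -> H} := gl_fun (r (MkHeis (v : V) 0)).
Definition weyl_cocycle (u v : Vf) : bool := beta_sign RR (u : V) (v : V).

Lemma weylE (v : Vf) z x : r (MkHeis (v : V) z) x = psi RR z *: weyl v x.
Proof.
rewrite -rH.2 /weyl -[RHS]/((r (MkHeis 0 z) * r (MkHeis (v : V) 0))%g x) -gmulfM.
congr (gl_fun (r _) x); rewrite -[RHS]/(heis_mul _ _) /heis_mul /=.
by rewrite add0r addr0 beta0l addr0.
Qed.

Lemma weyl0 x : weyl 0 x = x.
Proof. by rewrite -[RHS]scale1r -(psi0 RR K) -rH.2. Qed.

Lemma weylM u v x : weyl u (weyl v x) = (-1) ^+ weyl_cocycle u v *: weyl (u + v) x.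
Proof.
rewrite -[LHS]/((r (MkHeis (u : V) 0) * r (MkHeis (v : V) 0))%g x) -gmulfM.
rewrite -psi_signE ?beta_2torsion // -weylE.
congr (gl_fun (r _) x); rewrite -[LHS]/(heis_mul _ _) /heis_mul /=.
by rewrite !add0r.
Qed.

(** The span of the orbit of v0 is invariant and non-zero. *)
Lemma heis_spanned (v0 : H) : v0 != 0 ->
  forall x, exists f : Vf -> RR[i], x = \sum_v f v *: weyl v v0.
Proof.
move=> v00 x.
pose S : {pred H} := fun x => `[< exists f : Vf -> RR[i], x = \sum_v f v *: weyl v v0 >].
have Sv0 : v0 \in S.
  apply/asboolP; exists (fun v => (v == 0)%:R); rewrite (bigD1 0) //= eqxx scale1r weyl0.
  by rewrite big1 ?addr0 // => v /negPf ->; rewrite scale0r.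
have Scl : submod_closed S.
  split; first by apply/asboolP; exists (fun=> 0); rewrite big1 // => v _; rewrite scale0r.
  move=> a _ _ /asboolP[f ->] /asboolP[g ->]; apply/asboolP; exists (fun v => a * f v + g v).
  rewrite scaler_sumr -big_split; apply: eq_bigr => v _.
  by rewrite scalerDl scalerA.
have Sinv g v : v \in S -> r g v \in S.
  move=> /asboolP[f ->]; case: g => u z; apply/asboolP.
  exists (fun v => psi RR z * f (v + u) * (-1) ^+ weyl_cocycle u (v + u)).
  rewrite (weylE (u : Vf)) linear_sum scaler_sumr (reindex_inj (addIr (u : Vf))).
  apply: eq_bigr => w _; rewrite linearZ /= weylM !scalerA.
  have wu2 : (u : Vf) + (w + u) = w by rewrite addrCA (mod2_exponent u : (u : Vf) + u = 0) addr0.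
  by rewrite wu2.
have [S0|Sall] := rH.1.2 S Scl Sinv; last exact/asboolP/(Sall x).
by rewrite (S0 v0 Sv0) eqxx in v00.
Qed.

(** A has an eigenvector since H is finitely spanned, and the eigenspace is invariant. *)
Lemma schur (A : {linear H -> H}) : (forall h x, A (r h x) = r h (A x)) ->
  exists a, forall x, A x = a *: x.
Proof.
move=> Acomm; have [[v0 v00] irr] := rH.1.
have [|a [v [v_neq0 Av]]] := @spanned_eigenvector _ H #|Vf| (fun i => weyl (enum_val i) v0) A v0 v00.
  move=> x; have [f ->] := heis_spanned v00 x; exists (fun i => f (enum_val i)).
  by rewrite -(big_enum_val (fun v => f v *: weyl v v0)).
exists a; pose S : {pred H} := fun x => A x == a *: x.
have Scl : submod_closed S.
  split; first by rewrite unfold_in linear0 scaler0.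
  move=> b x y; rewrite !unfold_in => /eqP xE /eqP yE.
  by rewrite linearP xE yE scalerDr !scalerA mulrC.
have Sinv g x : x \in S -> r g x \in S.
  by rewrite !unfold_in => /eqP xE; rewrite Acomm xE linearZ.
have [S0|h x] := irr S Scl Sinv; last by apply/eqP/(h x).
have vS : v \in S by rewrite unfold_in Av.
by rewrite (S0 v vS) eqxx in v_neq0.
Qed.

Definition intertwines (g : ASp D) (A : GL H) := forall h x, A (r h x) = r (asp_act g h) (A x).

Lemma intertwinesP g A : intertwines g A <-> forall h, (A * r h * A^-1)%g = r (asp_act g h).
Proof.
split=> h k; first by apply: gl_eq => x /=; rewrite h gl_invK.
by move=> x; rewrite -h /= gl_funK.
Qed.

(** Two operators that implement the same g differ by one that commutes with the
    representation, that is by a scalar. *)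
Lemma intertwines_projective g A : intertwines g A -> to_PGL A = projective_rep r g.
Proof.
move=> gA; rewrite /projective_rep.
pose Q : set (PGL H) := [set P | exists2 A : GL H, P = to_PGL A &
  forall h, (A * r h * A^-1)%g = r (asp_act g h)]%classic.
rewrite -/Q.
have [B -> /intertwinesP gB] : Q (xget (to_PGL 1%g) Q).
  by apply: (@xgetPex _ _ Q); exists (to_PGL A); exists A => //; apply/intertwinesP.
have lin : linear (fun x => gl_inv_fun B (A x)) by move=> a x y; rewrite gl_linear gl_inv_linear.
pose L : {linear H -> H} := HB.pack (fun x => gl_inv_fun B (A x)) (GRing.isLinear.Build _ _ _ _ _ lin).
have [|a aE] := @schur L.
  by move=> h x /=; apply: (can_inj (gl_funK B)); rewrite gl_invK gA gB gl_invK.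
have AE x : A x = a *: B x by rewrite -linearZ -aE /= gl_invK.
have [[v0 v00] _] := rH.1.
have a0 : a != 0.
  apply/eqP => a0; move/eqP: v00; apply; apply: (can_inj (gl_funK A)).
  by rewrite AE a0 scale0r linear0.
by apply/eqmodP; apply/asboolP; exists a.
Qed.

Lemma asp_actM (g h : ASp D) k : asp_act (g * h)%g k = asp_act g (asp_act h k).
Proof. by rewrite /asp_act /= -addrA [asp_alpha h _ + _]addrC. Qed.

Lemma intertwines_div g h A B : intertwines g A -> intertwines h B ->
  intertwines (g * h^-1)%g (A * B^-1)%g.
Proof.
move=> gA hB k x /=; rewrite asp_actM -gA; congr (gl_fun A _).
apply: (can_inj (gl_funK B)); rewrite gl_invK hB -asp_actM mulgV gl_invK.
by case: k => v z; rewrite /asp_act /= addr0.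
Qed.

Definition star_unitary (A : GL H) := star_pair weyl weyl_cocycle A (A^-1)%g.

Lemma weyl_cocycleDl u u' v :
  weyl_cocycle (u + u') v = weyl_cocycle u v (+) weyl_cocycle u' v.
Proof. exact: beta_signDl. Qed.
Lemma weyl_cocycleDr u v v' :
  weyl_cocycle u (v + v') = weyl_cocycle u v (+) weyl_cocycle u v'.
Proof. exact: beta_signDr. Qed.

Lemma star_unitary_div A B : star_unitary A -> star_unitary B -> star_unitary (A * B^-1)%g.
Proof.
move=> sA /star_pair_sym sB.
rewrite /star_unitary invMg invgK.
exact: (star_pair_mul weylM weyl_cocycleDl weyl_cocycleDr sA sB).
Qed.

(** The pair (g, psi o alpha) satisfies the hypotheses of [weyl_intertwiner], the functional
    equation being the definition of Sigma_g. *)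
Lemma exists_lift (Kur : unramified K) (g : ASp D) : exists A, intertwines g A /\ star_unitary A.
Proof.
pose T (v : Vf) : Vf := val (asp_g g) (v : V).
pose a (v : Vf) : RR[i] := psi RR (asp_alpha g (v : V)).
have TD u v : T (u + v) = T u + T v by rewrite /T; apply: (linearD (val (asp_g g))).
have Tinj : injective T by apply: can_inj (gl_funK (val (asp_g g))).
have aD u v : a (u + v) = a u * a v * (-1) ^+ (weyl_cocycle (T u) (T v) (+) weyl_cocycle u v).
  rewrite signr_addb /weyl_cocycle -!psi_signE ?beta_2torsion // /a -!psiD; congr (psi RR _).
  have := asp_Sigma g (u : V) (v : V) => /= E.
  have -> : beta (u : V) (v : V) = - beta (u : V) (v : V).
    by apply/eqP; rewrite -addr_eq0 -mulr2n -mulr_natl beta_2torsion.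
  by rewrite -E -[_ - _ - _]addrA -opprD [RHS]addrC subrK.
have a4 v : a v ^+ 4 = 1 by apply: psiX4.
have VV (v : Vf) : v + v = 0 by apply: mod2_exponent.
have nd (t : Vf) : (forall v, weyl_cocycle v t = weyl_cocycle t v) -> t = 0.
  by apply: beta_sign_nondeg Kur.
have [A [B [Alin AK BK sAB AW]]] :=
  weyl_intertwiner weyl0 weylM weyl_cocycleDl weyl_cocycleDr VV nd TD Tinj aD a4.
pose A' := MkGL Alin (Bijective AK BK); exists A'; split.
  move=> [v z] x; rewrite (weylE (v : Vf)) linearZ /= AW scalerA -psiD.
  by rewrite (weylE (T v)).
apply: star_pair_ext sAB => x //=.
by apply: (can_inj (gl_funK A')); rewrite gl_invK /= BK.
Qed.

(** By Schur's lemma an operator that implements 1 is a scalar, and star-unitarity places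
    this scalar in Z[i, 1/2] with absolute value 1. *)
Lemma star_unitary_scalar (Kur : unramified K) (A : GL H) :
  intertwines 1%g A /\ star_unitary A <-> exists z : mu4 RR[i], A = scalar_gl H z.
Proof.
have VV (v : Vf) : v + v = 0 by apply: mod2_exponent.
have nd (t : Vf) : (forall v, weyl_cocycle v t = weyl_cocycle t v) -> t = 0.
  by apply: beta_sign_nondeg Kur.
have act1 (h : Heis D) : asp_act 1%g h = h by case: h => v z; rewrite /asp_act /= addr0.
have [[v0 v00] _] := rH.1.
split=> [[A1 sA]|[z ->]].
  have [a aE] : exists a, forall x, A x = a *: x.
    by apply: schur => h x; have := A1 h x; rewrite act1.
  have a0 : a != 0.
    apply/eqP => a0; move/eqP: v00; apply; apply: (can_inj (gl_funK A)).
    by rewrite aE a0 scale0r linear0.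
  have AVE x : (A^-1)%g x = a^-1 *: x.
    by apply: (can_inj (gl_funK A)); rewrite /= gl_invK aE scalerA mulfV // scale1r.
  have [aG aV] : dyadic_gauss a /\ a^-1 = a^*%R.
    apply: (star_pair_scalar weyl0 weylM weyl_cocycleDl weyl_cocycleDr VV nd v00).
    exact: star_pair_ext aE AVE sA.
  have a4 : a ^+ 4 == 1 by apply/eqP/dyadic_gauss_norm1 => //; rewrite -aV mulfV.
  by exists (exist (fun z : RR[i] => is_true (z ^+ 4 == 1)) a a4); apply: gl_eq.
split; first by move=> h x; rewrite act1 /= linearZ.
have z4 := eqP (valP z); have z0 := mu4_neq0 z.
have zV : (val z)^-1 = (val z)^*%R.
  apply: (mulfI z0); rewrite mulfV // -normCK.
  have : `|val z| ^+ 4 = 1 by rewrite -normrX z4 normr1.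
  by move/eqP; rewrite pexprn_eq1 //= => /eqP ->; rewrite expr1n.
apply: star_pair_ext (star_pair_scale (dyadic_gauss_fourth_root z4)
  (star_pair_id weyl0 weyl_cocycleDl)) => x //=.
by apply: (can_inj (gl_funK (scalar_gl H z))); rewrite gl_invK /= -zV scalerA mulfV // scale1r.
Qed.

End Representation.

Theorem theorem2p3 (RR : realType) (d : nat) (K : fieldExtType Q2)
    (K_degree : \dim {:K} = d) (K_unramified : unramified K)
    (n : nat) (D : split_symplectic K n)
    (H : lmodType RR[i]) (r : {multiplicative Heis D -> GL H})
    (r_heisenberg : heisenberg_representation r) :
  exists (AMp : groupType) (i : {multiplicative mu4 RR[i] -> AMp})
         (p : {multiplicative AMp -> ASp D}) (rho : {multiplicative AMp -> GL H}),
    central_extension i p /\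
    forall x : AMp, to_PGL (rho x) = projective_rep r (p x).
Proof.
have [s sP] := mod2_enum D.
pose P : {pred ASp D * GL H} := fun x => `[< intertwines r x.1 x.2 /\ star_unitary r sP x.2 >].
have [[v0 v00] _] := r_heisenberg.1.
have Pcl : group_closed P.
  split.
    apply/asboolP/(star_unitary_scalar r_heisenberg sP K_unramified).
    by exists 1%g; apply: gl_eq => v /=; rewrite scale1r.
  move=> x y /asboolP[ix sx] /asboolP[iy sy]; apply/asboolP; split.
    exact: intertwines_div.
  exact: star_unitary_div.
have Psurj g : exists A, (g, A) \in P.
  have [A gA] := exists_lift r_heisenberg sP K_unramified g.
  by exists A; apply/asboolP.
have Pker A : (1%g, A) \in P <-> exists z : mu4 RR[i], A = scalar_gl H z.
  rewrite -(star_unitary_scalar r_heisenberg sP K_unramified A).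
  by split => [/asboolP|h]; last apply/asboolP.
have [E [i [p [rho [ext lift]]]]] := central_extension_of_lifts v00 Pcl Psurj Pker.
exists E, i, p, rho; split => // x.
by apply: intertwines_projective => //; have /asboolP[] := lift x.
Qed.
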